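(* Let $\mathcal{M}=\langle\mathbb{R},<,+,\ldots\rangle$ be an o-minimal structure whose theory is decidable. Let $\mathcal{H}$ be a cycle-reset stochastic hybrid system defined in $\mathcal{M}$, let $B\in\Sigma_{\mathcal{H}}$ be definable in $\mathcal{M}$, and let $\mu\in\mathrm{Dist}(S_{\mathcal{H}})$ be an initial distribution. Assume that: (i) for all states $s\in L\times\mathbb{R}^n$, if $I(s)$ is finite, then the delay distribution $\mu_s$ is equivalent to the uniform discrete distribution on $I(s)$, and if $I(s)$ is infinite, then $\mu_s$ is equivalent to the Lebesgue measure on $I(s)$; (ii) the initial distribution $\mu$ is either equivalent to the discrete measure on some finite definable support $D$, or equivalent to the Lebesgue measure on a definable support $D$; (iii) for every edge $e\in E$ and $v\in\mathbb{R}^n$, the set $\mathcal{R}_e(v)$ is finite or has positive Lebesgue measure, and the reset distribution $\eta_e(v)$ is, respectively, equivalent to the discrete measure or to the Lebesgue measure on $\mathcal{R}_e(v)$. Then one can decide whether $\mathrm{Prob}^{\mathcal{T}_{\mathcal{H}}}_\mu(\mathbf{F}\,B)=1$ and whether $\mathrm{Prob}^{\mathcal{T}_{\mathcal{H}}}_\mu(\mathbf{F}\,B)=0$.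
   Context: Stochastic transition systems. An STS is a tuple $\mathcal{T}=(S,\Sigma,\kappa)$ with $(S,\Sigma)$ a measurable space and $\kappa\colon S\times\Sigma\to[0,1]$ a Markov kernel ($\kappa(s,\cdot)$ is a probability measure for every $s$; $\kappa(\cdot,A)$ is measurable for every $A\in\Sigma$). $\mathrm{Dist}(S)$ is the set of probability distributions on $(S,\Sigma)$. For $\mu\in\mathrm{Dist}(S)$, $\mathrm{Prob}^{\mathcal{T}}_\mu$ is the probability measure on runs (infinite sequences $s_0s_1\ldots$ of states) for which $s_0$ has law $\mu$ and $s_{i+1}$ is drawn from $\kappa(s_i,\cdot)$. $\mathbf{F}\,B$ is the set of runs with $s_i\in B$ for some $i\ge 0$. Equivalence of measures. A probability distribution $\mu$ is equivalent to a measure $\nu$ on a measurable set $A$ if $\mu$ is supported on $A$ ($\mu(A)=1$) and for every measurable $C\subseteq A$, $\mu(C)>0$ if and only if $\nu(C)>0$. On $L\times\mathbb{R}^n$, Lebesgue measure means the product of the counting measure on $L$ and Lebesgue measure on $\mathbb{R}^n$. Hybrid systems. A hybrid system (HS) is a tuple $(L,X,\mathcal{A},E,\gamma,\mathcal{I},\mathcal{G},\mathcal{R})$ where $L$ is a finite set of locations; $X=\{x_1,\ldots,x_n\}$ is a finite set of continuous variables; $\mathcal{A}$ is a finite alphabet of events; $E\subseteq L\times\mathcal{A}\times L$ is a finite set of edges; for each $\ell\in L$, $\gamma_\ell\colon\mathbb{R}^n\times\mathbb{R}^+\to\mathbb{R}^n$ is a continuous function (the dynamics in $\ell$; $\mathbb{R}^+=[0,\infty)$);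 $\mathcal{I}(\ell)\subseteq\mathbb{R}^n$ is the invariant of $\ell$; $\mathcal{G}(e)\subseteq\mathbb{R}^n$ is the guard of edge $e$; and for each edge $e$ and $v\in\mathbb{R}^n$, $\mathcal{R}_e(v)\subseteq\mathbb{R}^n$ is the reset. States are the elements of $L\times\mathbb{R}^n$. There is a switch-transition $(\ell,v)\xrightarrow{e}(\ell',v')$ for $e=(\ell,a,\ell')\in E$ if $v\in\mathcal{I}(\ell)\cap\mathcal{G}(e)$ and $v'\in\mathcal{R}_e(v)\cap\mathcal{I}(\ell')$; edge $e$ is then said to be enabled at $(\ell,v)$. There is a delay-transition $(\ell,v)\xrightarrow{\tau}(\ell,v')$ for $\tau\in\mathbb{R}^+$ if $\gamma_\ell(v,\tau')\in\mathcal{I}(\ell)$ for all $0\le\tau'\le\tau$ and $v'=\gamma_\ell(v,\tau)$. A mixed transition $\xrightarrow{\tau,e}$ is a delay-transition $\xrightarrow{\tau}$ followed by a switch-transition $\xrightarrow{e}$. For $s=(\ell,v)$, $s+\tau=(\ell,\gamma_\ell(v,\tau))$. $I(s,e)$ is the set of $\tau\in\mathbb{R}^+$ such that $s\xrightarrow{\tau,e}s'$ for some $s'$, and $I(s)=\bigcup_e I(s,e)$. Standing assumption: all states are non-blocking, i.e., $I(s)\ne\emptyset$ for every state $s$. Stochastic hybrid systems. A stochastic hybrid system (SHS) is a HS (with guards, invariants and resets Borel sets) together with: for each state $s$, a probability distribution $\mu_s$ on $\mathbb{R}^+$ (delays) with $\mu_s(I(s))=1$; for each edge $e$ and $v\in\mathbb{R}^n$,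 a probability distribution $\eta_e(v)$ on $\mathcal{R}_e(v)$; and for each state $s$ at which some edge is enabled, a probability distribution $p_s$ on $E$ such that $p_s(e)>0$ if and only if $e$ is enabled at $s$. Induced STS. $\mathcal{T}_{\mathcal{H}}=(S_{\mathcal{H}},\Sigma_{\mathcal{H}},\kappa_{\mathcal{H}})$, where $S_{\mathcal{H}}=L\times\mathbb{R}^n$, $\Sigma_{\mathcal{H}}$ is the product of $2^L$ and the Borel $\sigma$-algebra of $\mathbb{R}^n$, and for $s=(\ell,v)$, $B\in\Sigma_{\mathcal{H}}$, $$\kappa_{\mathcal{H}}(s,B)=\int_{\tau\in\mathbb{R}^+}\sum_{e=(\ell,a,\ell')\in E}\Big(p_{s+\tau}(e)\int_{v''\in\mathbb{R}^n}\mathbf{1}_B(\ell',v'')\,d\big(\eta_e(\gamma_\ell(v,\tau))\big)(v'')\Big)d\mu_s(\tau).$$ The data of an SHS are assumed to be such that $\kappa_{\mathcal{H}}$ is a (well-defined) Markov kernel, so that $\mathcal{T}_{\mathcal{H}}$ is an STS. Cycle-reset. An edge $e$ of an SHS is strongly reset if there exist $\mathcal{R}_e^*\subseteq\mathbb{R}^n$ and $\eta_e^*\in\mathrm{Dist}(\mathcal{R}_e^* )$ such that for all $v\in\mathcal{G}(e)$, $\mathcal{R}_e(v)=\mathcal{R}_e^*$ and $\eta_e(v)=\eta_e^*$. An SHS is cycle-reset if every simple cycle of its discrete graph (vertices $L$, edges $E$) contains a strongly reset edge. Definability. Definable means first-order definable without parameters in $\mathcal{M}$. A subset $C\subseteq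 L\times\mathbb{R}^n$ is definable if for each $\ell\in L$ the set $\{v\mid(\ell,v)\in C\}$ is definable. A totally ordered structure $\langle M,<,\ldots\rangle$ is o-minimal if every definable subset of $M$ is a finite union of points and open intervals (possibly unbounded). An SHS is defined in $\mathcal{M}$ if for every location $\ell$, the function $\gamma_\ell$ and the set $\mathcal{I}(\ell)$ are definable in $\mathcal{M}$, and for every edge $e$, the set $\mathcal{G}(e)$ is definable and there is a first-order formula $\psi_e(x,y)$ such that $v'\in\mathcal{R}_e(v)$ if and only if $\psi_e(v,v')$ is true in $\mathcal{M}$. Decidability. ''One can decide'' means that (for fixed $\mathcal{M}$) there is an algorithm which, given as input the finite discrete data of $\mathcal{H}$ and first-order formulas defining the flows, invariants, guards and resets of $\mathcal{H}$, the set $B$, and the support $D$ of $\mu$, answers each of the two questions correctly.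
   Formalization: O-minimality is taken in its usual sense, for subsets of the reals definable with parameters; read with parameter-free definability, as the context literally says, the claim is false. The system, B and D remain definable without parameters. *)

(* Defs.v *)
From HB Require Import structures.
From mathcomp Require Import all_boot all_order all_algebra.
From mathcomp Require Import all_classical all_reals all_analysis.
From mathcomp Require Import measurable_realfun.

Set Implicit Arguments.
Unset Strict Implicit.
Unset Printing Implicit Defensive.
Import Order.TTheory GRing.Theory Num.Theory.
Import numFieldNormedType.Exports.

Local Open Scope classical_set_scope.
Local Open Scope ring_scope.

(* Algorithms are programs of the WHILE language of N. D. Jones, Computability
   and Complexity from a Programming Perspective: a Turing-complete imperative
   language over binary trees. *)

Inductive tree := Leaf | Node of tree & tree.

Definition tree_hd (t : tree) := if t is Node a _ then a else Leaf.
Definition tree_tl (t : tree) := if t is Node _ b then b else Leaf.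

Inductive expr :=
  | EVar of nat
  | ELeaf
  | ENode of expr & expr
  | EHd of expr
  | ETl of expr.

Inductive cmd :=
  | Assign of nat & expr
  | Seq of cmd & cmd
  | While of expr & cmd.

Definition store := nat -> tree.

Definition upd (T : Type) (rho : nat -> T) (x : nat) (a : T) : nat -> T :=
  fun y => if y == x then a else rho y.

Fixpoint eval_expr (st : store) (e : expr) : tree :=
  match e with
  | EVar x => st x
  | ELeaf => Leaf
  | ENode a b => Node (eval_expr st a) (eval_expr st b)
  | EHd a => tree_hd (eval_expr st a)
  | ETl a => tree_tl (eval_expr st a)
  end.

Inductive exec : cmd -> store -> store -> Prop :=
  | exec_assign x e st : exec (Assign x e) st (upd st x (eval_expr st e))
  | exec_seq c1 c2 st1 st2 st3 :
      exec c1 st1 st2 -> exec c2 st2 st3 -> exec (Seq c1 c2) st1 st3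
  | exec_while_stop e c st :
      eval_expr st e = Leaf -> exec (While e c) st st
  | exec_while_loop e c st1 st2 st3 :
      eval_expr st1 e <> Leaf -> exec c st1 st2 -> exec (While e c) st2 st3 ->
      exec (While e c) st1 st3.

(* A program reads its input from, and leaves its output in, variable 0; all
   other variables are initially Leaf. [exec] is deterministic, so there is at
   most one output. *)
Definition outputs (c : cmd) (input output : tree) : Prop :=
  exists2 st, exec c (upd (fun=> Leaf) 0%N input) st & st 0%N = output.

Definition tree_true := Node Leaf Leaf.
Definition tree_false := Leaf.

Definition answers (c : cmd) (input : tree) (Q : Prop) : Prop :=
  (Q -> outputs c input tree_true) /\ (~ Q -> outputs c input tree_false).

Definition enc_seq (s : seq tree) : tree := foldr Node Leaf s.
Definition enc_nat (n : nat) : tree := enc_seq (nseq n Leaf).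

(* The symbols of the language other than [<] and [+]. *)
Record signature := Signature {
  fun_sym : countType;
  fun_arity : fun_sym -> nat;
  rel_sym : countType;
  rel_arity : rel_sym -> nat }.

Inductive term (sg : signature) :=
  | TVar of nat
  | TAdd of term sg & term sg
  | TFun (f : fun_sym sg) of ('I_(fun_arity f) -> term sg).
Arguments TVar {sg}.
Arguments TFun {sg}.

Inductive formula (sg : signature) :=
  | FEq of term sg & term sg
  | FLt of term sg & term sg
  | FRel (r : rel_sym sg) of ('I_(rel_arity r) -> term sg)
  | FNot of formula sg
  | FAnd of formula sg & formula sg
  | FEx of nat & formula sg.
Arguments FRel {sg}.

Record structure (R : realType) (sg : signature) := Structure {
  fun_interp : forall f : fun_sym sg, (fun_arity f).-tuple R -> R;
  rel_interp : forall r : rel_sym sg, (rel_arity r).-tuple R -> Prop }.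

Section FirstOrder.
Variables (R : realType) (sg : signature).

Fixpoint term_vars (t : term sg) : seq nat :=
  match t with
  | TVar x => [:: x]
  | TAdd t1 t2 => term_vars t1 ++ term_vars t2
  | TFun f ts => flatten [seq term_vars (ts i) | i <- enum 'I_(fun_arity f)]
  end.

Fixpoint free_vars (phi : formula sg) : seq nat :=
  match phi with
  | FEq t1 t2 | FLt t1 t2 => term_vars t1 ++ term_vars t2
  | FRel r ts => flatten [seq term_vars (ts i) | i <- enum 'I_(rel_arity r)]
  | FNot p => free_vars p
  | FAnd p q => free_vars p ++ free_vars q
  | FEx x p => [seq y <- free_vars p | y != x]
  end.

Variable M : structure R sg.

Fixpoint eval_term (rho : nat -> R) (t : term sg) : R :=
  match t with
  | TVar x => rho x
  | TAdd t1 t2 => eval_term rho t1 + eval_term rho t2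
  | TFun f ts => fun_interp M [tuple eval_term rho (ts i) | i < fun_arity f]
  end.

Fixpoint sat (rho : nat -> R) (phi : formula sg) : Prop :=
  match phi with
  | FEq t1 t2 => eval_term rho t1 = eval_term rho t2
  | FLt t1 t2 => eval_term rho t1 < eval_term rho t2
  | FRel r ts => rel_interp M [tuple eval_term rho (ts i) | i < rel_arity r]
  | FNot p => ~ sat rho p
  | FAnd p q => sat rho p /\ sat rho q
  | FEx x p => exists a : R, sat (upd rho x a) p
  end.

(* Definability without parameters: coordinate i of a point is variable i. *)
Definition defines (N : nat) (phi : formula sg) (A : set (N.-tuple R)) : Prop :=
  all (fun x => x < N)%N (free_vars phi) /\
  forall v : N.-tuple R, sat (fun i => nth 0 v i) phi <-> A v.

Definition finite_union_of_points_and_open_intervals (A : set R) : Prop :=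
  exists (pts : seq R) (ints : seq (\bar R * \bar R)), forall a : R,
    A a <-> a \in pts \/ exists2 J, J \in ints & (J.1 < a%:E < J.2)%E.

(* In the definition of o-minimality definable means, as usual, definable with
   parameters: these are the values rho takes at the variables other than x. *)
Definition o_minimal : Prop :=
  forall (phi : formula sg) (rho : nat -> R) (x : nat),
    finite_union_of_points_and_open_intervals
      [set a | sat (upd rho x a) phi].

End FirstOrder.

Section Encoding.
Variable sg : signature.

Fixpoint enc_term (t : term sg) : tree :=
  match t with
  | TVar x => enc_seq [:: enc_nat 0; enc_nat x]
  | TAdd t1 t2 => enc_seq [:: enc_nat 1; enc_term t1; enc_term t2]
  | TFun f ts => enc_seq [:: enc_nat 2; enc_nat (pickle f);
                   enc_seq [seq enc_term (ts i) | i <- enum 'I_(fun_arity f)]]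
  end.

Fixpoint enc_formula (phi : formula sg) : tree :=
  match phi with
  | FEq t1 t2 => enc_seq [:: enc_nat 0; enc_term t1; enc_term t2]
  | FLt t1 t2 => enc_seq [:: enc_nat 1; enc_term t1; enc_term t2]
  | FRel r ts => enc_seq [:: enc_nat 2; enc_nat (pickle r);
                   enc_seq [seq enc_term (ts i) | i <- enum 'I_(rel_arity r)]]
  | FNot p => enc_seq [:: enc_nat 3; enc_formula p]
  | FAnd p q => enc_seq [:: enc_nat 4; enc_formula p; enc_formula q]
  | FEx x p => enc_seq [:: enc_nat 5; enc_nat x; enc_formula p]
  end.

End Encoding.

Definition decidable_theory (R : realType) (sg : signature)
    (M : structure R sg) : Prop :=
  exists c : cmd, forall phi : formula sg, free_vars phi = [::] ->
    answers c (enc_formula phi) (forall rho : nat -> R, sat M rho phi).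

(* Finite sets of locations carry the discrete sigma-algebra. *)
HB.instance Definition _ (k : nat) := isPointed.Build 'I_k.+1 ord0.
HB.instance Definition _ (k : nat) :=
  @isMeasurable.Build default_measure_display 'I_k.+1 discrete_measurable
    discrete_measurable0 discrete_measurableC discrete_measurableU.

Notation Rn R n := (n.-tuple R).
Notation location k := 'I_k.+1.
(* The existence of a distribution on states forces the set of locations to be
   nonempty, whence the successor in ['I_k.+1]. *)
Notation state R k n := ('I_k.+1 * n.-tuple R)%type.

Section Measures.
Variable R : realType.

Definition supported_on d (T : measurableType d) (mu : set T -> \bar R)
    (A : set T) : Prop :=
  measurable A /\ mu A = 1%E.

Definition equivalent_on d (T : measurableType d) (mu nu : set T -> \bar R)
    (A : set T) : Prop :=
  supported_on mu A /\
  forall C : set T, measurable C -> C `<=` A -> ((0 < mu C)%E <-> (0 < nu C)%E).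

Definition discrete_uniform (T : choiceType) (A C : set T) : \bar R :=
  (fine (counting (A `&` C) : \bar R) / fine (counting A : \bar R))%:E.

(* R^n.+1 is R * R^n, with the product of the Lebesgue measures. *)
Fixpoint lebesgue_Rn (n : nat) : set (Rn R n) -> \bar R :=
  match n with
  | 0%N => fun C => \d_([tuple] : Rn R 0) C
  | n'.+1 => fun C =>
      (\int[@lebesgue_measure R]_x
         lebesgue_Rn [set v : Rn R n' | C [tuple of x :: v]])%E
  end.

Definition lebesgue_state (k n : nat) (C : set (state R k n)) : \bar R :=
  (\sum_(l < k.+1) lebesgue_Rn [set v | C (l, v)])%E.

End Measures.

Section STS.
Context d (S : measurableType d) (R : realType).

Definition run_cylinders : set (set (nat -> S)) :=
  \bigcup_i preimage_set_system setT (fun w : nat -> S => w i) measurable.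

Definition runs := g_sigma_algebraType run_cylinders.

(* Probability that the successors of s successively lie in the members of A. *)
Fixpoint prob_path (kappa : R.-pker S ~> S) (A : seq (set S)) (s : S) : \bar R :=
  match A with
  | [::] => 1%E
  | A0 :: A' => (\int[kappa s]_(s' in A0) prob_path kappa A' s')%E
  end.

(* P is the law of the runs s_0 s_1 ... for which s_0 has law mu and s_{i+1}
   is drawn from kappa s_i: by the Ionescu-Tulcea theorem there is exactly one
   probability measure with these values on the cylinders. *)
Definition run_law (mu : probability S R) (kappa : R.-pker S ~> S)
    (P : probability runs R) : Prop :=
  forall (A0 : set S) (A : seq (set S)),
    measurable A0 -> (forall i, measurable (nth setT A i)) ->
    P [set w | A0 (w 0%N) /\
               forall i, (i < size A)%N -> nth setT A i (w i.+1)] =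
    (\int[mu]_(s in A0) prob_path kappa A s)%E.

Definition eventually_in (B : set S) : set runs := [set w | exists i, B (w i)].

End STS.

(* n continuous variables, k.+1 locations, m events; an edge is a triple
   (source, event, target). *)
Notation edge k m := ('I_k.+1 * 'I_m * 'I_k.+1)%type.
Notation source e := e.1.1.
Notation target e := e.2.

Section HybridSystems.
Variables (R : realType) (k m n : nat).
Local Notation V := (Rn R n).
Local Notation S := (state R k n).

(* The value of [flow] at negative times, and those of [guard] and [reset] at
   triples that are not edges, are irrelevant. *)
Record hybrid_system := HybridSystem {
  edges : {set edge k m};
  flow : location k -> V -> R -> V;
  loc_inv : location k -> set V;
  guard : edge k m -> set V;
  reset : edge k m -> V -> set V;
  (* Joint continuity on R^n x R^+; row vectors carry the topology of R^n. *)
  flow_continuous : forall l : location k,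
    {within [set vt : 'rV[R]_n * R | 0 <= vt.2], continuous
      (fun vt : 'rV[R]_n * R =>
         \row_i tnth (flow l [tuple vt.1 0 j | j < n] vt.2) i)} }.

Section Transitions.
Variable H : hybrid_system.

Definition switch (e : edge k m) (s s' : S) : Prop :=
  [/\ e \in edges H, s.1 = source e & s'.1 = target e] /\
  [/\ loc_inv H (source e) s.2, guard H e s.2,
      reset H e s.2 s'.2 & loc_inv H (target e) s'.2].

Definition enabled (e : edge k m) (s : S) : Prop := exists s', switch e s s'.

Definition elapse (s : S) (tau : R) : S := (s.1, flow H s.1 s.2 tau).

Definition delay (tau : R) (s s' : S) : Prop :=
  [/\ 0 <= tau,
      forall t, 0 <= t <= tau -> loc_inv H s.1 (flow H s.1 s.2 t)
    & s' = elapse s tau].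

Definition mixed (tau : R) (e : edge k m) (s s' : S) : Prop :=
  exists s1, delay tau s s1 /\ switch e s1 s'.

Definition delays_edge (s : S) (e : edge k m) : set R :=
  [set tau | exists s', mixed tau e s s'].

Definition delays (s : S) : set R :=
  \bigcup_(e in [set` edges H]) delays_edge s e.

Definition non_blocking : Prop := forall s, delays s !=set0.

Definition simple_cycle (c : seq (edge k m)) : Prop :=
  [/\ c <> [::], {subset c <= edges H},
      path.cycle (fun e e' => target e == source e') c
    & uniq [seq source e | e <- c]].

End Transitions.

Record stochastic_hybrid_system := StochasticHybridSystem {
  hs :> hybrid_system;
  hs_non_blocking : non_blocking hs;
  measurable_loc_inv : forall l, measurable (loc_inv hs l);
  measurable_guard : forall e, e \in edges hs -> measurable (guard hs e);
  measurable_reset : forall e v, e \in edges hs -> measurable (reset hs e v);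
  delay_law : S -> probability R R;
  delay_law_supp : forall s, supported_on (delay_law s) (delays hs s);
  reset_law : edge k m -> V -> probability V R;
  reset_law_supp : forall e v, e \in edges hs ->
    supported_on (reset_law e v) (reset hs e v);
  (* The distribution p_s on edges, extended by 0 to the states s at which no
     edge is enabled. *)
  edge_law : S -> edge k m -> R;
  edge_law_ge0 : forall s e, e \in edges hs -> 0 <= edge_law s e;
  edge_law_gt0 : forall s e, e \in edges hs ->
    (0 < edge_law s e <-> enabled hs e s);
  edge_law_sum : forall s, (exists e, enabled hs e s) ->
    \sum_(e in edges hs) edge_law s e = 1 }.

Section Semantics.
Variable H : stochastic_hybrid_system.

Local Notation nonneg_reals := [set tau : R | 0 <= tau].

Definition kappa_integrand (s : S) (B : set S) (tau : R) : \bar R :=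
  (\sum_(e in edges H | source e == s.1)
     (edge_law H (elapse H s tau) e)%:E *
     \int[reset_law H e (flow H s.1 s.2 tau)]_v
        (\1_B (target e, v) : R)%:E)%E.

Definition kappa (s : S) (B : set S) : \bar R :=
  (\int[delay_law H s]_(tau in nonneg_reals) kappa_integrand s B tau)%E.

(* The integrals [kappa s B] are well defined and [kappa] is the Markov kernel
   K. *)
Definition induces (K : R.-pker S ~> S) : Prop :=
  forall (s : S) (B : set S), measurable B ->
    measurable_fun nonneg_reals (kappa_integrand s B) /\ K s B = kappa s B.

Definition strongly_reset (e : edge k m) : Prop :=
  exists (A : set V) (eta : probability V R), supported_on eta A /\
    forall v, guard H e v ->
      reset H e v = A /\
      forall C, measurable C -> reset_law H e v C = eta C.

Definition cycle_reset : Prop :=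
  forall c, simple_cycle H c -> exists2 e, e \in c & strongly_reset e.

Definition delay_condition : Prop := forall s : S,
  (finite_set (delays H s) ->
     equivalent_on (delay_law H s) (discrete_uniform R (delays H s))
       (delays H s)) /\
  (infinite_set (delays H s) ->
     equivalent_on (delay_law H s) (@lebesgue_measure R) (delays H s)).

Definition reset_condition : Prop := forall e v, e \in edges H ->
  (finite_set (reset H e v) /\
     equivalent_on (reset_law H e v) (@counting _ R) (reset H e v)) \/
  ((0 < lebesgue_Rn (reset H e v))%E /\
     equivalent_on (reset_law H e v) (@lebesgue_Rn R n) (reset H e v)).

End Semantics.

Definition initial_condition (mu : probability S R) (D : set S) : Prop :=
  (finite_set D /\ equivalent_on mu (@counting _ R) D) \/
  equivalent_on mu (@lebesgue_state R k n) D.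

End HybridSystems.

Record presentation (sg : signature) (k m n : nat) := Presentation {
  pr_edges : {set edge k m};
  pr_flow : location k -> formula sg;
  pr_invariant : location k -> formula sg;
  pr_guard : edge k m -> formula sg;
  pr_reset : edge k m -> formula sg;
  pr_target : location k -> formula sg;
  pr_support : location k -> formula sg }.

(* The formulas of the presentation define the (graphs of the) flows and the
   resets, the invariants, the guards, the target set B and the support D. *)
Definition presents (R : realType) (sg : signature) (M : structure R sg)
    (k m n : nat) (I : presentation sg k m n) (H : hybrid_system R k m n)
    (B D : set (state R k n)) : Prop :=
  [/\ pr_edges I = edges H,
      forall l,
        [/\ defines M (pr_flow I l)
              [set w : (n + n.+1).-tuple R | exists (v : Rn R n) (t : R),
                 0 <= t /\ w = [tuple of v ++ t :: flow H l v t]],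
            defines M (pr_invariant I l) (loc_inv H l),
            defines M (pr_target I l) [set v : Rn R n | B (l, v)]
          & defines M (pr_support I l) [set v : Rn R n | D (l, v)]]
    & forall e, e \in edges H ->
        defines M (pr_guard I e) (guard H e) /\
        defines M (pr_reset I e)
          [set w : (n + n).-tuple R | exists v v' : Rn R n,
             reset H e v v' /\ w = [tuple of v ++ v']]].

Definition enc_edge (sg : signature) (k m n : nat)
    (I : presentation sg k m n) (e : edge k m) : tree :=
  enc_seq [:: enc_nat (source e); enc_nat e.1.2; enc_nat (target e);
              enc_formula (pr_guard I e); enc_formula (pr_reset I e)].

Definition enc_location (sg : signature) (k m n : nat)
    (I : presentation sg k m n) (l : location k) : tree :=
  enc_seq [:: enc_formula (pr_flow I l); enc_formula (pr_invariant I l);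
              enc_formula (pr_target I l); enc_formula (pr_support I l)].

Definition enc_presentation (sg : signature) (k m n : nat)
    (I : presentation sg k m n) : tree :=
  enc_seq [:: enc_nat n; enc_nat k.+1; enc_nat m;
    enc_seq [seq enc_edge I e | e <- enum (pr_edges I)];
    enc_seq [seq enc_location I l | l <- enum 'I_k.+1]].

(* Main.v *)
(* Call [s] a predecessor of [X] if the kernel gives [X] positive probability from
   [s]. By o-minimality a definable set of reals is finite or contains an open
   interval, so under the equivalence assumptions "positive probability" is a
   first-order condition (existence of a point, or iterated existence of intervals),
   and the predecessors of a definable set are definable. Let [P] be the set of states
   reaching [B] with positive probability, [Z] its complement, and [Q] the set of states
   reaching [Z] with positive probability while avoiding [B]. Then [F B] has probability
   0 iff [mu P = 0], and probability 1 iff [mu Q = 0].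

   Cycle-resetness is used twice. The edges that are not strongly reset form an acyclic
   graph, so a window of [k+1] steps takes a strongly reset edge, after which the law of
   the state depends on the edge only. Hence the iterations computing [P] and [Q] stop
   after [(|E|+1)(k+1)] steps: whenever they do not stop within [k+1] steps, one more
   strongly reset edge has come to lead into the current set. And for the same reason
   the probability of reaching [B] or [Z] within a fixed number of steps is bounded
   below uniformly in the state, so that almost surely one of them is reached. *)

(* Whether a delay or reset law is discrete or continuous depends on the state, so the case
   distinction must happen inside the formula. One test covers both cases: a subset [X] of a support
   [A] has positive probability iff [X] is [many], or [A] is not [many] and [X] is nonempty. Since
   [many] treats one coordinate at a time and Lebesgue measure is an iterated integral, the two are
   compared slice by slice, and o-minimality is only used for sets of reals, with parameters.

   The obstacle in the probability-one question is that a positive hitting probability at each of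
   infinitely many states gives no common lower bound. A strongly reset edge has a single law, so
   continuity of measure yields one bound valid on half of its mass; finitely many edges share a
   bound, and it is carried across the other edges by an induction on a rank, at a factor of 2 per
   step.

   The program never takes the input formulas apart: it wraps their codes in connectives and renames
   variables by quantifying over them, so that no substitution has to be programmed. *)
Require Import Defs.
From HB Require Import structures.
From mathcomp Require Import all_boot all_order all_algebra.
From mathcomp Require Import all_classical all_reals all_analysis.
From mathcomp Require Import measurable_realfun.
From mathcomp Require Import zify lra.

Set Implicit Arguments.
Unset Strict Implicit.
Unset Printing Implicit Defensive.
Import Order.TTheory GRing.Theory Num.Theory.
Import numFieldNormedType.Exports.

(** * Computability by WHILE programs *)

Section Computable.
Local Open Scope nat_scope.

(** The index [b] is a stack pointer: the program may overwrite every register from [b] on and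
    assumes nothing about those above [b], so programs for subexpressions can be stacked without
    cleaning up. *)
Definition computes (c : nat -> cmd) (f : tree -> tree) :=
  forall b st, exists st', [/\ exec (c b) st st', st' b = f (st b)
    & forall x, x < b -> st' x = st x].

Definition computable f := exists c, computes c f.

Lemma upd_same (T : Type) (st : nat -> T) x a : upd st x a x = a.
Proof. by rewrite /upd eqxx. Qed.

Lemma upd_other (T : Type) (st : nat -> T) x a y : y != x -> upd st x a y = st y.
Proof. by rewrite /upd => /negbTE ->. Qed.

Lemma computable_expr (e : nat -> expr) f :
  (forall b st, eval_expr st (e b) = f (st b)) -> computable f.
Proof.
move=> ef; exists (fun b => Assign b (e b)) => b st; eexists; split.
- exact: exec_assign.
- by rewrite upd_same ef.
- by move=> x xb; rewrite upd_other// ltn_eqF.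
Qed.

Lemma computable_id : computable id.
Proof. exact: (computable_expr (e := EVar)). Qed.

Lemma computable_const u : computable (fun=> u).
Proof.
pose q := fix q u := if u is Node a b then ENode (q a) (q b) else ELeaf.
apply: (computable_expr (e := fun=> q u)) => b st.
by elim: u => //= a -> c ->.
Qed.

Lemma computable_comp f g : computable f -> computable g -> computable (f \o g).
Proof.
move=> [c cf] [d dg]; exists (fun b => Seq (d b) (c b)) => b st.
have [st1 [e1 v1 s1]] := dg b st; have [st2 [e2 v2 s2]] := cf b st1.
exists st2; split; [exact: exec_seq e1 e2 | by rewrite v2 v1 |].
by move=> x xb; rewrite s2// s1.
Qed.

Lemma computable_hd f : computable f -> computable (fun t => tree_hd (f t)).
Proof.
by move=> cf; apply: (computable_comp (f := tree_hd)) => //;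
  exact: (computable_expr (e := fun b => EHd (EVar b))).
Qed.

Lemma computable_tl f : computable f -> computable (fun t => tree_tl (f t)).
Proof.
by move=> cf; apply: (computable_comp (f := tree_tl)) => //;
  exact: (computable_expr (e := fun b => ETl (EVar b))).
Qed.

Lemma computable_node f g : computable f -> computable g ->
  computable (fun t => Node (f t) (g t)).
Proof.
move=> [c cf] [d dg].
exists (fun b => Seq (Assign b.+1 (EVar b)) (Seq (c b.+1)
  (Seq (Assign b.+2 (EVar b)) (Seq (d b.+2)
    (Assign b (ENode (EVar b.+1) (EVar b.+2))))))) => b st.
pose st1 := upd st b.+1 (st b).
have [st2 [e2 v2 s2]] := cf b.+1 st1.
pose st3 := upd st2 b.+2 (st2 b).
have [st4 [e4 v4 s4]] := dg b.+2 st3.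
exists (upd st4 b (Node (st4 b.+1) (st4 b.+2))); split.
- apply: exec_seq; first exact: exec_assign.
  apply: exec_seq; first exact: e2.
  apply: exec_seq; first exact: exec_assign.
  by apply: exec_seq; [exact: e4 | exact: exec_assign].
- rewrite upd_same s4// v4 /st3 upd_same upd_other; last by rewrite ltn_eqF.
  rewrite v2 /st1 upd_same s2// /st1 upd_other//.
  by rewrite ltn_eqF.
- move=> x xb; have xb1 : x < b.+1 by rewrite ltnS ltnW.
  rewrite upd_other; last by rewrite ltn_eqF.
  rewrite s4; last by rewrite ltnS ltnW.
  rewrite /st3 upd_other; last by rewrite ltn_eqF// ltnS ltnW.
  by rewrite s2// /st1 upd_other// ltn_eqF.
Qed.

(** Every tree is a list along its right spine, so the folds below are total; numerals are lists of
    leaves, and the same folds serve as bounded loops. *)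
Fixpoint elems (t : tree) : seq tree :=
  if t is Node a b then a :: elems b else [::].

Lemma elems_enc_seq s : elems (enc_seq s) = s.
Proof. by elim: s => //= a s ->. Qed.

(** Register [b] keeps the environment, [b.+1] the rest of the list and [b.+2] the accumulator;
    [b.+3] packs environment, accumulator and current element for the loop body. *)
Lemma exec_foldl c h env b : computes c (fun p =>
    h (tree_hd p) (tree_hd (tree_tl p)) (tree_tl (tree_tl p))) ->
  forall l st, st b = env -> st b.+1 = l ->
  exists st', [/\ exec (While (EVar b.+1) (Seq
      (Assign b.+3 (ENode (EVar b) (ENode (EVar b.+2) (EHd (EVar b.+1)))))
      (Seq (c b.+3) (Seq (Assign b.+2 (EVar b.+3))
        (Assign b.+1 (ETl (EVar b.+1))))))) st st',
    st' b.+2 = foldl (h env) (st b.+2) (elems l)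
    & forall x, x < b -> st' x = st x].
Proof.
move=> ch; elim=> [|a _ l IH] st stb stl.
  by exists st; split=> //; apply: exec_while_stop.
have bne n m : n < m -> (b + n == b + m) = false.
  by move=> nm; rewrite eqn_add2l ltn_eqF.
pose st1 := upd st b.+3 (Node (st b) (Node (st b.+2) (tree_hd (st b.+1)))).
have [st2 [e2 v2 s2]] := ch b.+3 st1.
pose st3 := upd st2 b.+2 (st2 b.+3).
pose st4 := upd st3 b.+1 (tree_tl (st3 b.+1)).
have st4b : st4 b = env.
  rewrite /st4 /st3 !upd_other ?ltn_eqF ?leqnSn//.
  rewrite s2; last by rewrite ltnW// ltnW.
  by rewrite /st1 upd_other// ltn_eqF// ltnW// ltnW.
have st4l : st4 b.+1 = l.
  rewrite /st4 upd_same /st3 upd_other; last by rewrite ltn_eqF.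
  rewrite s2; last by rewrite ltnW.
  by rewrite /st1 upd_other ?stl// ltn_eqF// ltnW.
have [st5 [e5 v5 s5]] := IH st4 st4b st4l.
exists st5; split.
- apply: exec_while_loop; [by rewrite /= stl | | exact: e5].
  apply: exec_seq; first exact: exec_assign.
  apply: exec_seq; first exact: e2.
  by apply: exec_seq; exact: exec_assign.
- rewrite v5 /= /st4 upd_other; last by rewrite gtn_eqF.
  by rewrite /st3 upd_same v2 /st1 upd_same/= stl stb.
- move=> x xb; rewrite s5// /st4 upd_other; last by rewrite ltn_eqF// ltnW.
  rewrite /st3 upd_other; last by rewrite ltn_eqF// ltnW// ltnW.
  rewrite s2; last by rewrite ltnW// ltnW// ltnW.
  by rewrite /st1 upd_other// ltn_eqF// ltnW// ltnW// ltnW.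
Qed.

Lemma computable_foldl h z l :
  computable (fun p => h (tree_hd p) (tree_hd (tree_tl p)) (tree_tl (tree_tl p))) ->
  computable z -> computable l ->
  computable (fun t => foldl (h t) (z t) (elems (l t))).
Proof.
move=> [c ch] cz cl.
have [d dn] := computable_node computable_id (computable_node cl cz).
exists (fun b => Seq (d b) (Seq (Assign b.+1 (EHd (ETl (EVar b))))
  (Seq (Assign b.+2 (ETl (ETl (EVar b)))) (Seq (Assign b (EHd (EVar b)))
  (Seq (While (EVar b.+1) (Seq
      (Assign b.+3 (ENode (EVar b) (ENode (EVar b.+2) (EHd (EVar b.+1)))))
      (Seq (c b.+3) (Seq (Assign b.+2 (EVar b.+3))
        (Assign b.+1 (ETl (EVar b.+1)))))))
  (Assign b (EVar b.+2))))))) => b st.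
have [st1 [e1 v1 s1]] := dn b st.
pose st2 := upd st1 b.+1 (tree_hd (tree_tl (st1 b))).
pose st3 := upd st2 b.+2 (tree_tl (tree_tl (st2 b))).
pose st4 := upd st3 b (tree_hd (st3 b)).
have st2b : st2 b = st1 b by rewrite /st2 upd_other// ltn_eqF.
have st3b : st3 b = st1 b by rewrite /st3 upd_other// ltn_eqF// ltnW.
have st4b : st4 b = st b by rewrite /st4 upd_same st3b v1.
have st4b1 : st4 b.+1 = l (st b).
  rewrite /st4 upd_other ?gtn_eqF// /st3 upd_other ?ltn_eqF//.
  by rewrite /st2 upd_same v1.
have st4b2 : st4 b.+2 = z (st b).
  rewrite /st4 upd_other; last by rewrite gtn_eqF// ltnW.
  by rewrite /st3 upd_same st2b v1.
have [st5 [e5 v5 s5]] := exec_foldl ch st4b st4b1.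
exists (upd st5 b (st5 b.+2)); split.
- apply: exec_seq; first exact: e1.
  apply: exec_seq; first exact: exec_assign.
  apply: exec_seq; first exact: exec_assign.
  apply: exec_seq; first exact: exec_assign.
  by apply: exec_seq; [exact: e5|exact: exec_assign].
- by rewrite upd_same v5 st4b2.
- move=> x xb; rewrite upd_other; last by rewrite ltn_eqF.
  rewrite s5// /st4 upd_other ?ltn_eqF// /st3 upd_other; last first.
    by rewrite ltn_eqF// ltnW// ltnW.
  by rewrite /st2 upd_other ?s1// ltn_eqF// ltnW.
Qed.

Lemma computable_foldr h z l :
  computable (fun p => h (tree_hd p) (tree_hd (tree_tl p)) (tree_tl (tree_tl p))) ->
  computable z -> computable l ->
  computable (fun t => foldr (h t) (z t) (elems (l t))).
Proof.
move=> ch cz cl.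
pose push (t acc x : tree) := Node x acc.
have crev : computable (fun t => foldl (push t) Leaf (elems (l t))).
  apply: computable_foldl => //; last exact: computable_const.
  by apply: computable_node; [|apply: computable_hd]; do 2?apply: computable_tl;
    exact: computable_id.
have -> : (fun t => foldr (h t) (z t) (elems (l t))) =
    (fun t => foldl (fun acc x => h t x acc) (z t)
       (elems (foldl (push t) Leaf (elems (l t))))).
  apply/funext => t.
  have pushE s v : elems (foldl (push t) v s) = catrev s (elems v).
    by elim: s v => //= x s IH v; rewrite IH.
  by rewrite pushE /= -/(rev _) foldl_rev.
apply: (computable_foldl (h := fun t acc x => h t x acc)) => //.
pose swap p := Node (tree_hd p) (Node (tree_tl (tree_tl p)) (tree_hd (tree_tl p))).
apply: (computable_comp (g := swap) ch).
by apply: computable_node; [|apply: computable_node];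
  do ?[apply: computable_hd|apply: computable_tl];
  exact: computable_id.
Qed.

Definition tree_if (t a b : tree) := if t is Leaf then a else b.

Lemma computable_if f g h : computable f -> computable g -> computable h ->
  computable (fun t => tree_if (f t) (g t) (h t)).
Proof.
move=> cf cg ch.
have -> : (fun t => tree_if (f t) (g t) (h t)) =
    (fun t => foldl (fun _ _ => h t) (g t)
       (elems (if f t is Node _ _ then Node Leaf Leaf else Leaf))).
  by apply/funext => t; case: (f t).
apply: (computable_foldl (h := fun t _ _ => h t)) => //.
  apply: (computable_comp (f := h) (g := tree_hd)) => //.
  by apply: computable_hd; exact: computable_id.
apply: (computable_comp (f := fun u => if u is Node _ _ then Node Leaf Leaf else Leaf)) => //.
have -> : (fun u => if u is Node _ _ then Node Leaf Leaf else Leaf) =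
    (fun u => foldl (fun _ _ => Node Leaf Leaf) Leaf (elems u)).
  apply/funext; case=> //= a b; by elim: (elems b).
apply: (computable_foldl (h := fun _ _ _ => Node Leaf Leaf));
  [exact: computable_const|exact: computable_const|exact: computable_id].
Qed.

Fixpoint max_var_expr e :=
  match e with
  | EVar x => x
  | ELeaf => 0
  | ENode a b => maxn (max_var_expr a) (max_var_expr b)
  | EHd a | ETl a => max_var_expr a
  end.

Fixpoint max_var c :=
  match c with
  | Assign x e => maxn x (max_var_expr e)
  | Seq c1 c2 => maxn (max_var c1) (max_var c2)
  | While e c => maxn (max_var_expr e) (max_var c)
  end.

Lemma exec_frame c st st' : exec c st st' ->
  forall x, max_var c < x -> st' x = st x.
Proof.
elim=> {c st st'} //=.
- by move=> x e st y; rewrite gtn_max => /andP[xy _]; rewrite upd_other// gtn_eqF.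
- move=> c1 c2 st1 st2 st3 _ IH1 _ IH2 x; rewrite gtn_max => /andP[x1 x2].
  by rewrite IH2// IH1.
- move=> e c st1 st2 st3 _ _ IH1 _ IH2 x xm.
  by rewrite IH2// IH1//; move: xm; rewrite gtn_max => /andP[].
Qed.

(** The language has no skip command, so the base case already clears register 1; hence the
    [maxn 1 N] in [exec_clean]. *)
Definition clean N : cmd := iteri N (fun i c => Seq c (Assign i.+1 ELeaf))
  (Assign 1 ELeaf).

Lemma exec_clean N st : exec (clean N) st
  (fun x => if 0 < x <= maxn 1 N then Leaf else st x).
Proof.
elim: N => [|N IH] /=.
  have -> : (fun x => if 0 < x <= maxn 1 0 then Leaf else st x) =
      upd st 1 (eval_expr st ELeaf) by apply/funext => -[|[|x]].
  exact: exec_assign.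
apply: exec_seq IH _.
have -> : (fun x => if 0 < x <= maxn 1 N.+1 then Leaf else st x) =
   upd (fun x => if 0 < x <= maxn 1 N then Leaf else st x) N.+1 Leaf.
  apply/funext => x; rewrite /upd; case: eqP => [->|/eqP xN].
    by rewrite leq_max leqnn orbT.
  rewrite !leq_max; case: x xN => //= x; rewrite eqSS !ltnS => xN.
  by congr (if _ || _ then _ else _); rewrite [in LHS]leq_eqVlt (negbTE xN).
exact: exec_assign.
Qed.

(* The registers used by the first program are reset, since a program expects all
   registers but 0 to be initially [Leaf]. *)
Lemma outputs_computable f c : computable f ->
  exists d, forall t u, outputs c (f t) u -> outputs d t u.
Proof.
move=> [cf fP].
exists (Seq (Seq (cf 0) (clean (max_var (cf 0)))) c) => t u [st est st0].
have [st1 [e1 v1 _]] := fP 0 (upd (fun=> Leaf) 0 t).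
exists st => //; apply: exec_seq est; apply: exec_seq; first exact: e1.
have -> : upd (fun=> Leaf) 0 (f t) =
    fun x => if 0 < x <= maxn 1 (max_var (cf 0)) then Leaf else st1 x.
  apply/funext => x; case: ltnP => [x0|]; last first.
    by rewrite leqn0 => /eqP ->; rewrite upd_same v1 upd_same.
  rewrite upd_other; last by rewrite gtn_eqF.
  case: leqP => //; rewrite gtn_max => /andP[_ xm].
  by rewrite (exec_frame e1)// upd_other// gtn_eqF.
exact: exec_clean.
Qed.

End Computable.

(** * The decision procedure as a function on trees *)

Ltac computable_lemma := fail.
Ltac computable_step :=
  match goal with
  | |- computable id => exact: computable_id
  | |- computable (fun t => t) => exact: computable_id
  | |- computable (fun t => ?u) => exact: computable_const
  | H : computable _ |- _ => exact H
  | H : computable ?f |- computable (fun t => ?f (@?g t)) =>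
      apply: (computable_comp (f := f) (g := g) H)
  | |- computable (fun t => tree_hd (@?f t)) => apply: (@computable_hd f)
  | |- computable (fun t => tree_tl (@?f t)) => apply: (@computable_tl f)
  | |- computable (fun t => Node (@?f t) (@?g t)) => apply: (@computable_node f g)
  | |- computable (fun t => foldr (@?h t) (@?z t) (elems (@?l t))) =>
      apply: (@computable_foldr h z l); cbv beta
  | |- computable (fun t => tree_if (@?f t) (@?g t) (@?h t)) =>
      apply: (@computable_if f g h)
  end.
Ltac computable_tac := repeat first [computable_step | computable_lemma].

Definition tree_one := Node Leaf Leaf.

Definition tree_add a b := foldr (fun _ c => Node Leaf c) b (elems a).
Definition tree_range a n :=
  foldr (fun _ l => Node a (foldr (fun x r => Node (Node Leaf x) r) Leaf (elems l)))
    Leaf (elems n).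
Definition tree_drop i l := foldr (fun _ l' => tree_tl l') l (elems i).
Definition tree_nth l i := tree_hd (tree_drop i l).
(** Dropping one numeral from the other is truncated subtraction; the result is [Leaf], read as
    false, exactly when both differences vanish. *)
Definition tree_neq a b := tree_if (tree_drop a b) (tree_drop b a) tree_one.

Definition code c (s : seq tree) := enc_seq (enc_nat c :: s).
Definition tree_var x := code 0 [:: x].
Definition tree_eq x y := code 0 [:: tree_var x; tree_var y].
Definition tree_lt x y := code 1 [:: tree_var x; tree_var y].
Definition tree_not p := code 3 [:: p].
Definition tree_and p q := code 4 [:: p; q].
Definition tree_ex x p := code 5 [:: x; p].
Definition tree_or p q := tree_not (tree_and (tree_not p) (tree_not q)).
Definition tree_bot := tree_ex Leaf (tree_lt Leaf Leaf).
Definition tree_exs a n p := foldr tree_ex p (elems (tree_range a n)).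
(** Substitution without inspecting [p]: the variables from [a] on are quantified and equated with
    those from [b] on. The equations stay outside [p], so its bound variables are harmless; only the
    two blocks have to be disjoint. *)
Definition tree_plug a b n p :=
  foldr (fun i q => tree_ex (tree_add a i)
                      (tree_and (tree_eq (tree_add a i) (tree_add b i)) q))
    p (elems (tree_range Leaf n)).
(** The variable [y] and its successor are the ends of an open interval of values of [x]. The
    iteration below reuses them at every level: the outer ends are compared outside the inner
    formula, so shadowing is harmless. *)
Definition tree_many y x p :=
  tree_ex y (tree_ex (Node Leaf y) (tree_and (tree_lt y (Node Leaf y))
    (tree_not (tree_ex x (tree_and (tree_and (tree_lt y x) (tree_lt x (Node Leaf y)))
                                   (tree_not p)))))).
Definition tree_manys y a n p := foldr (tree_many y) p (elems (tree_range a n)).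

Definition edge_src e := tree_hd e.
Definition edge_tgt e := tree_hd (tree_tl (tree_tl e)).
Definition edge_guard e := tree_hd (tree_tl (tree_tl (tree_tl e))).
Definition edge_reset e := tree_hd (tree_tl (tree_tl (tree_tl (tree_tl e)))).
Definition loc_flow l := tree_hd l.
Definition loc_invariant l := tree_hd (tree_tl l).
Definition loc_target l := tree_hd (tree_tl (tree_tl l)).
Definition loc_support l := tree_hd (tree_tl (tree_tl (tree_tl l))).

(* The input formulas only use the free variables below [2n+1], so the arguments
   plugged into them are kept in the disjoint blocks [v], [w], [u] of [n] variables
   and in the variables [tau], [t]; [top] and its successor are left to the
   quantifiers [tree_many]. *)
Definition reg_v n := Node Leaf (tree_add n n).
Definition reg_w n := tree_add (reg_v n) n.
Definition reg_u n := tree_add (reg_w n) n.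
Definition reg_tau n := tree_add (reg_u n) n.
Definition reg_t n := Node Leaf (reg_tau n).
Definition reg_top n := Node Leaf (reg_t n).

Definition tree_at n a p := tree_plug Leaf a n p.
Definition tree_flow n loc tau :=
  tree_plug Leaf (reg_v n) n
    (tree_plug n tau tree_one
      (tree_plug (Node Leaf n) (reg_w n) n (loc_flow loc))).
Definition tree_reset n e :=
  tree_plug Leaf (reg_w n) n (tree_plug n (reg_u n) n (edge_reset e)).
Definition tree_stay n loc :=
  tree_not (tree_ex (reg_t n) (tree_exs (reg_w n) n
    (tree_and (tree_flow n loc (reg_t n))
      (tree_and (tree_not (tree_lt (reg_tau n) (reg_t n)))
                (tree_not (tree_at n (reg_w n) (loc_invariant loc))))))).
Definition tree_fire n locs loc e :=
  tree_and (tree_flow n loc (reg_tau n))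
    (tree_and (tree_at n (reg_w n) (loc_invariant loc))
      (tree_and (tree_at n (reg_w n) (edge_guard e))
        (tree_exs (reg_u n) n (tree_and (tree_reset n e)
          (tree_at n (reg_u n) (loc_invariant (tree_nth locs (edge_tgt e)))))))).
(** The invariant of the target location belongs to enabledness, hence to [tree_fire]; the reset law
    itself is not conditioned on it. *)
Definition tree_hit n X e :=
  let X' := tree_at n (reg_u n) (tree_nth X (edge_tgt e)) in
  tree_or (tree_manys (reg_top n) (reg_u n) n (tree_and (tree_reset n e) X'))
    (tree_and (tree_not (tree_manys (reg_top n) (reg_u n) n (tree_reset n e)))
      (tree_exs (reg_u n) n (tree_and (tree_reset n e) X'))).
Definition tree_delays n edges locs l :=
  tree_and (tree_stay n (tree_nth locs l))
    (tree_exs (reg_w n) n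
      (foldr (fun e p => tree_if (tree_neq (edge_src e) l)
                           (tree_or (tree_fire n locs (tree_nth locs l) e) p) p)
         tree_bot (elems edges))).
Definition tree_good_delays n edges locs X l :=
  tree_and (tree_stay n (tree_nth locs l))
    (tree_exs (reg_w n) n
      (foldr (fun e p => tree_if (tree_neq (edge_src e) l)
                           (tree_or (tree_and (tree_fire n locs (tree_nth locs l) e)
                                              (tree_hit n X e)) p) p)
         tree_bot (elems edges))).
(** Codes of state sets speak about variables 0 to n-1, which also receive the arguments of the
    input formulas; the current state is therefore first moved to block [v]. *)
Definition tree_pre n edges locs X l :=
  tree_plug (reg_v n) Leaf n
    (tree_or (tree_many (reg_top n) (reg_tau n) (tree_good_delays n edges locs X l))
      (tree_and
        (tree_not (tree_many (reg_top n) (reg_tau n) (tree_delays n edges locs l)))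
        (tree_ex (reg_tau n) (tree_good_delays n edges locs X l)))).

Definition inp_n i := tree_hd i.
Definition inp_locations i := tree_hd (tree_tl i).
Definition inp_edges i := tree_hd (tree_tl (tree_tl (tree_tl i))).
Definition inp_locs i := tree_hd (tree_tl (tree_tl (tree_tl (tree_tl i)))).

Definition tree_step i T X :=
  foldr (fun l r => Node (tree_or (tree_nth T l)
      (tree_and (tree_not (loc_target (tree_nth (inp_locs i) l)))
                (tree_pre (inp_n i) (inp_edges i) (inp_locs i) X l))) r)
    Leaf (elems (tree_range Leaf (inp_locations i))).
(** Numerals being lists, the inner fold makes [k+1] steps and the outer one [|E|+1] rounds, the
    added [Leaf] accounting for the [+1]. *)
Definition tree_reach i T :=
  foldr (fun _ X => foldr (fun _ Y => tree_step i T Y) X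
                      (elems (inp_locations i)))
    T (elems (Node Leaf (inp_edges i))).
Definition tree_targets i :=
  foldr (fun loc r => Node (loc_target loc) r) Leaf (elems (inp_locs i)).
Definition tree_complement X :=
  foldr (fun p r => Node (tree_not p) r) Leaf (elems X).

Definition tree_some_loc (f : tree -> tree) i :=
  foldr (fun l p => tree_or (f l) p) tree_bot
    (elems (tree_range Leaf (inp_locations i))).
Definition tree_init i X :=
  let S l := loc_support (tree_nth (inp_locs i) l) in
  tree_or
    (tree_some_loc (fun l => tree_manys (reg_top (inp_n i)) Leaf (inp_n i)
                               (tree_and (S l) (tree_nth X l))) i)
    (tree_and
      (tree_not (tree_some_loc (fun l =>
         tree_manys (reg_top (inp_n i)) Leaf (inp_n i) (S l)) i))
      (tree_some_loc (fun l => tree_exs Leaf (inp_n i)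
                               (tree_and (S l) (tree_nth X l))) i)).
(* The outer quantifiers are vacuous: they only make the formula closed. *)
Definition tree_null i X :=
  tree_exs Leaf (reg_top (inp_n i)) (tree_not (tree_init i X)).
Definition tree_decide_zero i := tree_null i (tree_reach i (tree_targets i)).
Definition tree_decide_one i :=
  tree_null i (tree_reach i (tree_complement (tree_reach i (tree_targets i)))).

(** * Computability of the decision procedure *)

Section ComputableAlgorithm.
Local Ltac unfold_basic :=
  rewrite /tree_many /tree_bot /tree_or /tree_ex /tree_and /tree_not /tree_lt /tree_eq
    /tree_var /code /=.

Lemma computable_add a b : computable a -> computable b ->
  computable (fun t => tree_add (a t) (b t)).
Proof. by move=> *; rewrite /tree_add; computable_tac. Qed.

Lemma computable_range a b : computable a -> computable b ->
  computable (fun t => tree_range (a t) (b t)).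
Proof. by move=> *; rewrite /tree_range; computable_tac. Qed.

Lemma computable_nth a b : computable a -> computable b ->
  computable (fun t => tree_nth (a t) (b t)).
Proof. by move=> *; rewrite /tree_nth /tree_drop; computable_tac. Qed.

Lemma computable_neq a b : computable a -> computable b ->
  computable (fun t => tree_neq (a t) (b t)).
Proof. by move=> *; rewrite /tree_neq /tree_drop /tree_one; computable_tac. Qed.

Lemma computable_not a : computable a -> computable (fun t => tree_not (a t)).
Proof. by move=> *; unfold_basic; computable_tac. Qed.

Lemma computable_and a b : computable a -> computable b ->
  computable (fun t => tree_and (a t) (b t)).
Proof. by move=> *; unfold_basic; computable_tac. Qed.

Lemma computable_or a b : computable a -> computable b ->
  computable (fun t => tree_or (a t) (b t)).
Proof. by move=> *; unfold_basic; computable_tac. Qed.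

Lemma computable_ex a b : computable a -> computable b ->
  computable (fun t => tree_ex (a t) (b t)).
Proof. by move=> *; unfold_basic; computable_tac. Qed.

Lemma computable_many a b c : computable a -> computable b -> computable c ->
  computable (fun t => tree_many (a t) (b t) (c t)).
Proof. by move=> *; unfold_basic; computable_tac. Qed.

Lemma computable_lt a b : computable a -> computable b ->
  computable (fun t => tree_lt (a t) (b t)).
Proof. by move=> *; unfold_basic; computable_tac. Qed.

Local Ltac computable_lemma ::= first
  [ apply: computable_add | apply: computable_range | apply: computable_nth
  | apply: computable_neq | apply: computable_or | apply: computable_many
  | apply: computable_lt | apply: computable_not | apply: computable_and
  | apply: computable_ex].

Lemma computable_exs a b c : computable a -> computable b -> computable c ->
  computable (fun t => tree_exs (a t) (b t) (c t)).
Proof. by move=> *; rewrite /tree_exs; computable_tac. Qed.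

Lemma computable_plug a b c d : computable a -> computable b -> computable c ->
  computable d -> computable (fun t => tree_plug (a t) (b t) (c t) (d t)).
Proof.
by move=> *; rewrite /tree_plug /tree_eq /tree_var /code /=; computable_tac.
Qed.

Lemma computable_manys a b c d : computable a -> computable b -> computable c ->
  computable d -> computable (fun t => tree_manys (a t) (b t) (c t) (d t)).
Proof. by move=> *; rewrite /tree_manys; computable_tac. Qed.

Local Ltac computable_lemma ::= first
  [ apply: computable_exs | apply: computable_plug | apply: computable_manys
  | apply: computable_add | apply: computable_range | apply: computable_nth
  | apply: computable_neq | apply: computable_or | apply: computable_many
  | apply: computable_lt | apply: computable_not | apply: computable_and
  | apply: computable_ex].

Lemma computable_pre a b c d e : computable a -> computable b -> computable c ->
  computable d -> computable e ->
  computable (fun t => tree_pre (a t) (b t) (c t) (d t) (e t)).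
Proof.
move=> *; rewrite /tree_pre /tree_good_delays /tree_delays /tree_stay /tree_fire
  /tree_hit /tree_flow /tree_reset /tree_at /tree_bot
  /edge_src /edge_tgt /edge_guard /edge_reset /loc_flow /loc_invariant
  /reg_top /reg_t /reg_tau /reg_u /reg_w /reg_v /tree_one.
by computable_tac.
Qed.

Lemma computable_reach_step a b c : computable a -> computable b -> computable c ->
  computable (fun t => tree_step (a t) (b t) (c t)).
Proof.
move=> *; rewrite /tree_step /inp_n /inp_edges /inp_locs /inp_locations /loc_target.
by repeat first [computable_step | apply: computable_pre | computable_lemma].
Qed.

Lemma computable_reach a b : computable a -> computable b ->
  computable (fun t => tree_reach (a t) (b t)).
Proof.
move=> *; rewrite /tree_reach /inp_edges /inp_locations.
by repeat first [computable_step | apply: computable_reach_step].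
Qed.

Lemma computable_null a b : computable a -> computable b ->
  computable (fun t => tree_null (a t) (b t)).
Proof.
move=> *; rewrite /tree_null /tree_init /tree_some_loc.
rewrite /inp_n /inp_edges /inp_locs /inp_locations /loc_support /tree_bot /reg_top
  /reg_t /reg_tau /reg_u /reg_w /reg_v.
by computable_tac.
Qed.

Lemma computable_targets : computable tree_targets.
Proof. by rewrite /tree_targets /loc_target /inp_locs; computable_tac. Qed.

Lemma computable_complement a : computable a ->
  computable (fun t => tree_complement (a t)).
Proof. by move=> *; rewrite /tree_complement; computable_tac. Qed.

Lemma computable_decide_zero : computable tree_decide_zero.
Proof.
apply: computable_null computable_id _.
exact: computable_reach computable_id computable_targets.
Qed.

Lemma computable_decide_one : computable tree_decide_one.
Proof.
apply: computable_null computable_id _; apply: computable_reach computable_id _.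
apply: computable_complement.
exact: computable_reach computable_id computable_targets.
Qed.

End ComputableAlgorithm.

(** * Trees representing definable sets *)

Section TreeArithmetic.
Local Open Scope nat_scope.

Lemma elems_enc_nat n : elems (enc_nat n) = nseq n Leaf.
Proof. exact: elems_enc_seq. Qed.

Lemma tree_addE a b : tree_add (enc_nat a) (enc_nat b) = enc_nat (a + b).
Proof. by rewrite /tree_add elems_enc_nat; elim: a => //= a ->. Qed.

Lemma tree_rangeE a n :
  tree_range (enc_nat a) (enc_nat n) = enc_seq [seq enc_nat i | i <- iota a n].
Proof.
rewrite /tree_range elems_enc_nat; elim: n => //= n ->.
rewrite elems_enc_seq -[a.+1]addn1 addnC iotaDl; congr Node.
by elim: (iota a n) => //= i s ->.
Qed.

Lemma tree_dropE i s : tree_drop (enc_nat i) (enc_seq s) = enc_seq (drop i s).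
Proof.
rewrite /tree_drop elems_enc_nat; elim: i s => [|i IH] s; first by rewrite drop0.
have -> : drop i.+1 s = behead (drop i s) by rewrite -drop1 drop_drop add1n.
by rewrite /= IH; case: (drop i s).
Qed.

Lemma tree_nthE s i : i < size s ->
  tree_nth (enc_seq s) (enc_nat i) = nth Leaf s i.
Proof. by move=> si; rewrite /tree_nth tree_dropE (drop_nth Leaf). Qed.

Lemma tree_neqE a b x y :
  tree_if (tree_neq (enc_nat a) (enc_nat b)) x y = if a == b then x else y.
Proof.
rewrite /tree_neq !tree_dropE !drop_nseq; case: (ltngtP a b) => [ab|ba|->].
- by have -> : b - a = (b - a).-1.+1 by lia.
- have -> : b - a = 0 by lia.
  by have -> : a - b = (a - b).-1.+1 by lia.
- by rewrite subnn.
Qed.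

End TreeArithmetic.

Section Representation.
Local Open Scope ring_scope.
Local Open Scope classical_set_scope.
Variables (R : realType) (sg : signature) (M : structure R sg).
Implicit Types (rho : nat -> R) (t : tree) (x : nat).

Lemma eval_term_ext rho rho' (t : term sg) :
  (forall x, x \in term_vars t -> rho x = rho' x) ->
  eval_term M rho t = eval_term M rho' t.
Proof.
elim: t => [x|t1 IH1 t2 IH2|f ts IH] /= e.
- by apply: e; rewrite inE.
- by rewrite IH1 ?IH2// => x xt; apply: e; rewrite mem_cat xt ?orbT.
- congr fun_interp; apply: eq_from_tnth => i; rewrite !tnth_mktuple.
  apply: IH => x xi; apply: e; apply/flatten_mapP.
  by exists i => //; rewrite mem_enum.
Qed.

Lemma sat_ext (phi : formula sg) rho rho' :
  (forall x, x \in free_vars phi -> rho x = rho' x) ->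
  sat M rho phi <-> sat M rho' phi.
Proof.
elim: phi rho rho' => [t1 t2|t1 t2|r ts|p IH|p IHp q IHq|x p IH] rho rho' /= e.
1,2: by rewrite (@eval_term_ext rho rho' t1) ?(@eval_term_ext rho rho' t2)// => x xt;
    apply: e; rewrite mem_cat xt ?orbT.
- suff -> : [tuple eval_term M rho (ts i) | i < rel_arity r] =
            [tuple eval_term M rho' (ts i) | i < rel_arity r] by [].
  apply: eq_from_tnth => i; rewrite !tnth_mktuple; apply: eval_term_ext => x xi.
  by apply: e; apply/flatten_mapP; exists i => //; rewrite mem_enum.
- by rewrite (IH rho rho').
- by rewrite (IHp rho rho') ?(IHq rho rho')// => x xt; apply: e;
    rewrite mem_cat xt ?orbT.
- split=> -[a pa]; exists a; [rewrite -(IH (upd rho x a))//|rewrite (IH _ (upd rho' x a))//];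
    move=> y yp; rewrite /upd; case: eqP => // /eqP yx; apply: e;
    by rewrite mem_filter yx.
Qed.

Definition block rho a n : n.-tuple R := map_tuple rho (iota_tuple n a).

Definition set_block rho a (v : seq R) : nat -> R :=
  fun x => if (a <= x < a + size v)%N then nth 0 v (x - a) else rho x.

Lemma tnth_block rho a n i : tnth (block rho a n) i = rho (a + i)%N.
Proof. by rewrite tnth_map (tnth_nth 0%N) /= nth_iota. Qed.

Lemma block_ext rho rho' a n :
  (forall x, (a <= x < a + n)%N -> rho x = rho' x) -> block rho a n = block rho' a n.
Proof.
move=> e; apply: eq_from_tnth => i; rewrite !tnth_block; apply: e.
by rewrite leq_addr ltn_add2l /=.
Qed.

Lemma set_block_out rho a v x : ~~ (a <= x < a + size v)%N -> set_block rho a v x = rho x.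
Proof. by rewrite /set_block => /negbTE ->. Qed.

Lemma block_set_block_disjoint rho a v b n : (a + size v <= b)%N || (b + n <= a)%N ->
  block (set_block rho a v) b n = block rho b n.
Proof. by move=> ab; apply: block_ext => x bx; rewrite set_block_out//; lia. Qed.

Lemma block_set_block rho a n (v : n.-tuple R) : block (set_block rho a v) a n = v.
Proof.
apply: eq_from_tnth => i; rewrite tnth_block /set_block size_tuple leq_addr ltn_add2l.
by rewrite ltn_ord addKn -tnth_nth.
Qed.

Lemma block_upd rho x c a n : ~~ (a <= x < a + n)%N ->
  block (upd rho x c) a n = block rho a n.
Proof.
by move=> ax; apply: block_ext => y ay; rewrite upd_other//; apply: contra ax => /eqP <-.
Qed.

Lemma set_block_nil rho a : set_block rho a [::] = rho.
Proof. by apply/funext => x; rewrite set_block_out//= addn0; lia. Qed.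

Lemma set_block_cons rho a c v :
  set_block rho a (c :: v) = set_block (upd rho a c) a.+1 v.
Proof.
apply/funext => x; rewrite /set_block /upd /= addSn addnS.
case: (ltngtP a x) => [ax|ax|<-] /=.
- by have -> : (x - a = (x - a.+1).+1)%N by lia.
- by [].
- by rewrite subnn ltnS leq_addr.
Qed.

Lemma block_cons rho a n : block rho a n.+1 = [tuple of rho a :: block rho a.+1 n].
Proof. exact: val_inj. Qed.

(* Iterates "for all points of some nonempty open interval", which for the sets
   occurring in an o-minimal structure means "for a set of positive Lebesgue
   measure". *)
Fixpoint many n : set (n.-tuple R) -> Prop :=
  match n with
  | 0%N => fun A => A [tuple]
  | n'.+1 => fun A => exists a b : R, a < b /\
      forall c, a < c < b -> many [set v : n'.-tuple R | A [tuple of c :: v]]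
  end.

Definition many1 (A : set R) := exists a b : R, a < b /\ `]a, b[ `<=` A.

Variable N : nat.

Definition represents t (X : set (nat -> R)) := exists phi : formula sg,
  [/\ t = enc_formula phi, all (fun x => x < N)%N (free_vars phi)
    & forall rho, sat M rho phi <-> X rho].

Lemma represents_ext t X Y : represents t X -> (forall rho, X rho <-> Y rho) ->
  represents t Y.
Proof. by move=> [p [tp fp sp]] XY; exists p; split=> // rho; rewrite sp. Qed.

Lemma represents_eq x y : (x < N)%N -> (y < N)%N ->
  represents (tree_eq (enc_nat x) (enc_nat y)) [set rho | rho x = rho y].
Proof. by move=> xN yN; exists (FEq (TVar x) (TVar y)); rewrite /= xN yN. Qed.

Lemma represents_lt x y : (x < N)%N -> (y < N)%N ->
  represents (tree_lt (enc_nat x) (enc_nat y)) [set rho | rho x < rho y].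
Proof. by move=> xN yN; exists (FLt (TVar x) (TVar y)); rewrite /= xN yN. Qed.

Lemma represents_not t X : represents t X -> represents (tree_not t) [set rho | ~ X rho].
Proof.
by move=> [p [-> fp sp]]; exists (FNot p); split=> // rho; rewrite /= sp.
Qed.

Lemma represents_and t u X Y : represents t X -> represents u Y ->
  represents (tree_and t u) [set rho | X rho /\ Y rho].
Proof.
move=> [p [-> fp sp]] [q [-> fq sq]]; exists (FAnd p q); split=> //=.
  by rewrite all_cat fp.
by move=> rho; rewrite sp sq.
Qed.

Lemma represents_or t u X Y : represents t X -> represents u Y ->
  represents (tree_or t u) [set rho | X rho \/ Y rho].
Proof.
move=> tX uY; apply: represents_ext.
  exact: represents_not (represents_and (represents_not tX) (represents_not uY)).
by move=> rho /=; rewrite -not_orE notE.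
Qed.

Lemma represents_ex t X x : represents t X ->
  represents (tree_ex (enc_nat x) t) [set rho | exists a, X (upd rho x a)].
Proof.
move=> [p [-> fp sp]]; exists (FEx x p); split=> //=.
  by apply/allP => y; rewrite mem_filter => /andP[_ /(allP fp)].
by move=> rho; split=> -[a]; exists a; apply/sp.
Qed.

Lemma represents_bot : represents tree_bot set0.
Proof.
by exists (FEx 0 (FLt (TVar 0) (TVar 0))); split=> // rho /=; split=> // -[a];
  rewrite ltxx.
Qed.

Lemma represents_many t X x : (x < N)%N -> represents t X ->
  represents (tree_many (enc_nat N) (enc_nat x) t)
    [set rho | many1 [set c | X (upd rho x c)]].
Proof.
move=> xN [p [-> fp sp]].
pose I : formula sg := FAnd (FLt (TVar N) (TVar x)) (FLt (TVar x) (TVar N.+1)).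
exists (FEx N (FEx N.+1 (FAnd (FLt (TVar N) (TVar N.+1))
   (FNot (FEx x (FAnd I (FNot p))))))); split=> [//||].
  apply/allP => y; cbn [free_vars term_vars I].
  rewrite !(mem_filter, mem_cat, inE).
  by have /= := allP fp y; case: (y \in free_vars p) => [/(_ isT)|_]; lia.
have xN0 : (x == N) = false by lia.
have xN1 : (x == N.+1) = false by lia.
have NN : (N == N.+1) = false by lia.
have N0x : (N == x) = false by lia.
have N1x : (N.+1 == x) = false by lia.
have satE rho a b c : sat M (upd (upd (upd rho N a) N.+1 b) x c) p <-> X (upd rho x c).
  rewrite -sp; apply: sat_ext => y /(allP fp) /= yN.
  rewrite /upd; case: eqP => // _; case: eqP => [|_]; first by lia.
  by case: eqP => //; lia.
have upd_top rho a b : upd (upd rho N a) N.+1 b N = a by rewrite /upd NN eqxx.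
have upd_top1 rho a b c : upd (upd (upd rho N a) N.+1 b) x c N = a.
  by rewrite upd_other ?N0x// upd_top.
have upd_top2 rho a b c : upd (upd (upd rho N a) N.+1 b) x c N.+1 = b.
  by rewrite upd_other ?N1x// upd_same.
move=> rho /=; split=> [[a [b []]]|[a [b [ab abX]]]].
  rewrite upd_top upd_same => ab H; exists a, b; split=> // c.
  rewrite /= in_itv /= => /andP[ac cb]; apply/(satE rho a b).
  apply: contrapT => nsat; apply: H; exists c.
  by split; [rewrite upd_top1 upd_top2 upd_same | exact: nsat].
exists a, b; split; first by rewrite upd_top upd_same.
case=> c [[]]; rewrite upd_top1 upd_top2 upd_same => ac cb.
by apply; apply/(satE rho a b)/abX; rewrite /= in_itv /=; exact/andP.
Qed.

Lemma represents_exs t X a n : represents t X ->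
  represents (tree_exs (enc_nat a) (enc_nat n) t)
    [set rho | exists v : n.-tuple R, X (set_block rho a v)].
Proof.
move=> tX; rewrite /tree_exs tree_rangeE elems_enc_seq foldr_map.
elim: n a => [|n IH] a /=.
  apply: represents_ext tX _ => rho; split=> [Xr|[v]].
    by exists [tuple]; rewrite set_block_nil.
  by rewrite tuple0 set_block_nil.
apply: represents_ext (represents_ex a (IH a.+1)) _ => rho; split.
  by move=> [c [v Xv]]; exists [tuple of c :: v]; rewrite set_block_cons.
by move=> [v]; case/tupleP: v => c v; rewrite set_block_cons => Xv; exists c, v.
Qed.

Lemma represents_manys t X a n : (a + n <= N)%N -> represents t X ->
  represents (tree_manys (enc_nat N) (enc_nat a) (enc_nat n) t)
    [set rho | many [set v : n.-tuple R | X (set_block rho a v)]].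
Proof.
move=> aN tX; rewrite /tree_manys tree_rangeE elems_enc_seq foldr_map.
elim: n a aN => [|n IH] a aN /=.
  by apply: represents_ext tX _ => rho /=; rewrite set_block_nil.
have aN' : (a.+1 + n <= N)%N by lia.
have aN'' : (a < N)%N by lia.
apply: represents_ext (represents_many aN'' (IH a.+1 aN')) _ => rho.
split=> -[b [c [bc H]]]; exists b, c; split=> // x.
  move=> /andP[bx xc]; have := H x; rewrite /= in_itv /= bx xc => /(_ isT).
  by congr many; apply/funext => v /=; rewrite set_block_cons.
rewrite /= in_itv => /H /=; congr many; apply/funext => v /=.
by rewrite set_block_cons.
Qed.

Lemma represents_plug t X a b n : (a + n <= b)%N || (b + n <= a)%N ->
  (a + n <= N)%N -> (b + n <= N)%N -> represents t X ->
  represents (tree_plug (enc_nat a) (enc_nat b) (enc_nat n) t)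
    [set rho | X (set_block rho a (block rho b n))].
Proof.
move=> ab aN bN tX; rewrite /tree_plug (tree_rangeE 0) elems_enc_seq foldr_map.
(* Generalised to the coordinates from [i] to [i+m-1], so that the induction peels off the outermost
   quantifier. *)
suff H i m : (i + m <= n)%N -> represents
    (foldr (fun i q => tree_ex (tree_add (enc_nat a) (enc_nat i))
      (tree_and (tree_eq (tree_add (enc_nat a) (enc_nat i))
                         (tree_add (enc_nat b) (enc_nat i))) q)) t (iota i m))
    [set rho | X (set_block rho (a + i) (block rho (b + i) m))].
  by apply: represents_ext (H 0%N n (leqnn _)) _ => rho; rewrite /= !addn0.
elim: m i => [|m IH] i im; rewrite [X in represents X]/=.
  by apply: represents_ext tX _ => rho; rewrite /= set_block_nil.
rewrite !tree_addE; have im' : (i.+1 + m <= n)%N by lia.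
have aiN : (a + i < N)%N by lia.
have biN : (b + i < N)%N by lia.
apply: represents_ext
  (represents_ex (a + i) (represents_and (represents_eq aiN biN) (IH i.+1 im'))) _ => rho.
have bi c : upd rho (a + i) c (b + i) = rho (b + i)%N by rewrite upd_other//; lia.
have bl c : block (upd rho (a + i) c) (b + i.+1) m = block rho (b + i.+1) m.
  by rewrite block_upd//; lia.
rewrite /mkset block_cons set_block_cons -!addnS; split=> [[c]|Xr].
  by rewrite upd_same bi bl => -[->].
by exists (rho (b + i)%N); rewrite upd_same bi bl.
Qed.

Lemma represents_defines n (phi : formula sg) (A : set (n.-tuple R)) : (n <= N)%N ->
  defines M phi A -> represents (enc_formula phi) [set rho | A (block rho 0 n)].
Proof.
move=> nN [fphi sphi]; exists phi; split=> //.
  by apply/allP => x /(allP fphi) /= xn; lia.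
move=> rho; rewrite -[X in _ <-> X]sphi; apply: sat_ext => x /(allP fphi) /= xn.
by rewrite (nth_map 0%N) ?size_iota// nth_iota.
Qed.

Lemma represents_bigor (T : eqType) (s : seq T) (enc : T -> tree)
    (f : tree -> tree -> tree) (X : T -> set (nat -> R)) :
  (forall e p Y, e \in s -> represents p Y ->
     represents (f (enc e) p) [set rho | X e rho \/ Y rho]) ->
  represents (foldr f tree_bot [seq enc e | e <- s])
    [set rho | exists2 e, e \in s & X e rho].
Proof.
elim: s => [|e s IH] fX /=.
  by apply: represents_ext represents_bot _ => rho; split=> // -[].
apply: represents_ext (fX e _ _ (mem_head _ _) (IH _)) _ => [e' p Y e's|rho].
  by apply: fX; rewrite inE e's orbT.
split=> [[Xe|[e' e's Xe]]|[e']].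
- by exists e => //; rewrite mem_head.
- by exists e' => //; rewrite inE e's orbT.
- by rewrite inE => /orP[/eqP ->|e's Xe]; [left|right; exists e'].
Qed.

End Representation.

Local Open Scope classical_set_scope.
Local Open Scope ring_scope.

(** * Lebesgue measure of o-minimal sets *)

Section Positivity.
Local Open Scope ereal_scope.

(** A nonnegative function has integral zero iff it vanishes almost everywhere. This reduces
    positivity of the kernel to positivity of the measure of a set of delays. *)
Lemma integral_gt0 d (T : measurableType d) (R : realType)
    (mu : {measure set T -> \bar R}) (D : set T) (f : T -> \bar R) :
  measurable D -> measurable_fun D f -> (forall x, D x -> 0 <= f x) ->
  0 < \int[mu]_(x in D) f x <-> 0 < mu (D `&` [set x | 0 < f x]).
Proof.
move=> mD mf f0; have mP : measurable (D `&` [set x | 0 < f x]).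
  exact: emeasurable_fun_o_infty.
have fabs : \int[mu]_(x in D) `|f x| = \int[mu]_(x in D) f x.
  by apply: eq_integral => x /set_mem Dx; rewrite gee0_abs// f0.
have neg : ae_eq mu D f (cst 0) <-> mu (D `&` [set x | 0 < f x]) = 0.
  rewrite -negligibleP//.
  suff <- : ~` [set x | D x -> f x = cst 0 x] = D `&` [set x | 0 < f x] by [].
  apply/seteqP; split=> x /=.
    by move=> /not_implyP[Dx /eqP fx]; split=> //; rewrite lt_neqAle eq_sym fx f0.
  by move=> [Dx fx] /(_ Dx) fx0; move: fx; rewrite fx0 ltxx.
rewrite !lt_neqAle !(eq_sym 0) measure_ge0 integral_ge0// !andbT -fabs.
split=> /eqP ne; apply/eqP => e; apply: ne.
  exact/(ae_eq_integral_abs mu mD mf)/neg.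
exact/neg/(ae_eq_integral_abs mu mD mf).
Qed.

Lemma probability_supportI d (T : measurableType d) (R : realType)
    (mu : probability T R) (A C : set T) : measurable A -> mu A = 1 -> measurable C ->
  mu (A `&` C) = mu C.
Proof.
move=> mA muA mC; have mAC := measurableC mA.
rewrite -[in RHS](setIT C) -(setUv A) setIUr measureU//; try exact: measurableI.
  rewrite [X in _ = _ + X](_ : _ = 0) ?adde0; first by rewrite setIC.
  apply/eqP; rewrite eq_le measure_ge0 andbT.
  have <- : mu (~` A) = 0 by rewrite probability_setC// muA subee.
  by apply: le_measure; rewrite ?inE//; exact: measurableI.
by rewrite setIACA setICr setI0.
Qed.

(* [large] stands for having positive Lebesgue measure; the discrete and the
   continuous case need not be told apart, except in dimension 0 where they agree. *)
Lemma equivalent_positive (T : Type) (R : realType) (mu : set T -> \bar R)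
    (large : set T -> Prop) (A C : set T) :
  0 < mu A -> C `<=` A ->
  (forall X, large X -> X !=set0) ->
  (finite_set A -> large A -> forall X, X !=set0 -> large X) ->
  (finite_set A /\ (0 < mu C <-> C !=set0)) \/
  ((0 < mu A -> large A) /\ (0 < mu C <-> large C)) ->
  0 < mu C <-> large C \/ ~ large A /\ C !=set0.
Proof.
move=> A0 CA ne fin; case=> [[fA ->]|[largeA ->]].
  have [lA|nlA] := pselect (large A).
    by split=> [C0|[/ne//|[]//]]; left; exact: fin.
  by split=> [C0|[/ne//|[]//]]; right.
by split=> [|[//|[]]]; [left|case; exact: largeA].
Qed.

End Positivity.

(** * Definable sets of reals *)

Section OMinimalSets.
Variable R : realType.
Implicit Types A : set R.

Local Notation tame1 := (@finite_union_of_points_and_open_intervals R).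

Lemma tame1_measurable A : tame1 A -> measurable A.
Proof.
move=> [pts [ints AP]].
have -> : A = [set` pts] `|` \bigcup_(J in [set` ints])
    (EFin @^-1` [set x | (J.1 < x < J.2)%E]).
  apply/seteqP; split=> a.
    by move=> /AP[|[J Ji aJ]]; [left|right; exists J].
  by case=> [?|[J Ji aJ]]; apply/AP; [left|right; exists J].
apply: measurableU.
  apply: countable_measurable => [x|]; first exact: measurable_set1.
  exact/finite_set_countable/finite_seq.
apply: fin_bigcup_measurable => // J _.
rewrite -[X in measurable X]setTI.
have -> : [set x | (J.1 < x < J.2)%E] = [set` `]J.1, J.2[%E].
  by apply/seteqP; split=> x /=; rewrite in_itv.
have mE : measurable_fun setT (EFin \o @id R) by exact/measurable_EFinP.
by apply: mE => //; exact: emeasurable_itv.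
Qed.

Lemma tame1_finite A : tame1 A -> ~ many1 A -> finite_set A.
Proof.
move=> [pts [ints AP]] nA; apply: (@sub_finite_set _ _ [set` pts]) => // a.
move=> /AP[//|[J Ji]]; move: (AP) => _ /andP[Ja aJ]; case: nA.
(* A nonempty interval of the union contains []b, a[], with [b] its left end if that is finite and
   [a - 1] otherwise. *)
have [b [ba Jb]] : exists b, b < a /\ (J.1 <= b%:E)%E.
  case: (J.1) Ja => [x xa| |]//.
    by exists x; rewrite -lte_fin.
  by exists (a - 1); rewrite ltrBlDr ltrDl ltr01 leNye.
exists b, a; split=> // c /=; rewrite in_itv /= => /andP[bc ca].
apply/AP; right; exists J => //; rewrite (le_lt_trans Jb) ?lte_fin//=.
by rewrite (lt_trans _ aJ)// lte_fin.
Qed.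

Lemma many1_infinite A : many1 A -> infinite_set A.
Proof.
move=> [a [b [ab abA]]] fA.
have /finite_set_countable/countable_lebesgue_measure0 : finite_set `]a, b[%classic.
  exact: sub_finite_set fA.
rewrite /= lebesgue_measure_itv /= lte_fin ab -EFinD => -[] /eqP.
by rewrite subr_eq0 gt_eqF.
Qed.

Lemma tame1_lebesgue A : tame1 A -> (0 < lebesgue_measure A)%E <-> many1 A.
Proof.
move=> tA; have mA := tame1_measurable tA; split=> [A0|[a [b [ab abA]]]].
  apply: contrapT => /(tame1_finite tA)/finite_set_countable.
  by move=> /countable_lebesgue_measure0 A00; rewrite A00 ltxx in A0.
apply: (@lt_le_trans _ _ (lebesgue_measure `]a, b[%classic)); last first.
  by apply: le_measure => //; rewrite inE.
by rewrite /= lebesgue_measure_itv /= lte_fin ab -EFinD lte_fin subr_gt0.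
Qed.

End OMinimalSets.

(** * Lebesgue measure in dimension n by slicing *)

Section LebesgueRn.
Variable R : realType.

Lemma lebesgue_Rn_ge0 n (A : set (n.-tuple R)) : (0 <= lebesgue_Rn A)%E.
Proof.
elim: n A => [|n IH] A /=; first by rewrite diracE lee_fin ler0n.
by apply: integral_ge0 => x _.
Qed.

(** The parameter space is arbitrary because the induction absorbs the first coordinate into it: [X]
    becomes [X * R], and Tonelli's theorem integrates that coordinate out. *)
Lemma measurable_lebesgue_Rn n d (X : measurableType d) (A : set (X * n.-tuple R)) :
  measurable A -> measurable_fun setT (fun x => lebesgue_Rn [set v | A (x, v)]).
Proof.
elim: n d X A => [|n IH] d X A mA /=.
  have -> : (fun x => \d_([tuple] : 0.-tuple R) [set v | A (x, v)]) =
     (EFin \o (\1_[set x | A (x, [tuple])] : X -> R)).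
    by apply/funext => x; rewrite /= diracE indicE /=; congr (_%:E).
  apply/measurable_EFinP/measurable_indic.
  rewrite -[X in measurable X]setTI.
  have mp : measurable_fun setT (fun x : X => (x, [tuple] : 0.-tuple R)).
    exact: measurable_fun_pair.
  exact: mp.
have mB : measurable [set z : (X * R) * n.-tuple R | A (z.1.1, [tuple of z.1.2 :: z.2])].
  have mg : measurable_fun setT (fun z : (X * R) * n.-tuple R =>
      (z.1.1, [the n.+1.-tuple R of z.1.2 :: z.2])).
    apply: measurable_fun_pair => /=.
      by apply: (measurableT_comp measurable_fst).
    apply: measurable_cons => //.
    by apply: (measurableT_comp measurable_snd).
  by rewrite -[X in measurable X]setTI; exact: mg.
pose g (z : X * measurableTypeR R) : \bar R :=
  lebesgue_Rn [set v : n.-tuple R | A (z.1, [tuple of (z.2 : R) :: v])].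
have mg : measurable_fun setT g by exact: (IH _ _ _ mB).
have g0 z : (0 <= g z)%E by exact: lebesgue_Rn_ge0.
exact: (measurable_fun_fubini_tonelli_F (m2 := @lebesgue_measure R) g mg g0).
Qed.

(* The sets definable in an o-minimal structure, as far as [many] is concerned. *)
Fixpoint tame n : set (n.-tuple R) -> Prop :=
  match n with
  | 0%N => fun=> True
  | n'.+1 => fun A =>
      finite_union_of_points_and_open_intervals
        [set c | many [set v : n'.-tuple R | A [tuple of c :: v]]] /\
      forall c, tame [set v : n'.-tuple R | A [tuple of c :: v]]
  end.

Lemma measurable_cons_section n (A : set (n.+1.-tuple R)) c : measurable A ->
  measurable [set v : n.-tuple R | A [tuple of c :: v]].
Proof.
move=> mA; rewrite -[X in measurable X]setTI.
have : measurable_fun setT (fun v : n.-tuple R => [the n.+1.-tuple R of c :: v]).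
  by apply: measurable_cons.
exact.
Qed.

(** The iterated integral is positive iff the set of first coordinates with a positive slice has
    positive measure. By induction this is the set that [tame] takes to be a finite union of points
    and intervals, for which positive measure means containing an interval. *)
Lemma lebesgue_Rn_many n (A : set (n.-tuple R)) : measurable A -> tame A ->
  (0 < lebesgue_Rn A)%E <-> many A.
Proof.
elim: n A => [|n IH] A mA tA /=.
  rewrite diracE lte_fin ltr0n lt0b; split=> [/set_mem//|?]; exact/mem_set.
case: tA => tA1 tA2.
have mA' : measurable [set z : R * n.-tuple R | A [tuple of z.1 :: z.2]].
  rewrite -[X in measurable X]setTI.
  have : measurable_fun setT (fun z : R * n.-tuple R =>
     [the n.+1.-tuple R of z.1 :: z.2]) by apply: measurable_cons.
  exact.
rewrite integral_gt0//; last 2 first.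
- exact: measurable_lebesgue_Rn mA'.
- by move=> x _; exact: lebesgue_Rn_ge0.
rewrite setTI; have -> :
    [set x : R | (0 < lebesgue_Rn [set v : n.-tuple R | A [tuple of x :: v]])%E] =
    [set c | many [set v : n.-tuple R | A [tuple of c :: v]]].
  by apply/seteqP; split=> x /=; rewrite (IH _ (measurable_cons_section x mA) (tA2 x)).
exact: tame1_lebesgue tA1.
Qed.

Lemma many_nonempty n (A : set (n.-tuple R)) : many A -> A !=set0.
Proof.
elim: n A => [|n IH] A /= => [A0|[a [b [ab H]]]]; first by exists [tuple].
have /H/IH[v Av] : a < (a + b) / 2 < b by rewrite midf_lt// midf_lt.
by exists [tuple of (a + b) / 2 :: v].
Qed.

(** In positive dimension the first coordinates of [A] would fill an interval. Dimension 0 is a true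
    exception: there the single point is [many]. *)
Lemma finite_many n (A : set (n.-tuple R)) : finite_set A -> many A -> n = 0%N.
Proof.
case: n A => //= n A fA [a [b [ab H]]].
have : many1 [set thead v | v in A].
  exists a, b; split=> // c /=; rewrite in_itv /= => /H/many_nonempty[v Av].
  by exists [tuple of c :: v].
by move=> /many1_infinite[]; exact: finite_image.
Qed.

End LebesgueRn.

(** * Reachability and avoidance in a Markov chain *)

Section ProbabilityIntegral.
Local Open Scope ereal_scope.
Context d (T : measurableType d) (R : realType) (mu : {measure set T -> \bar R}).
Hypothesis muT : mu setT = 1.

Lemma integral_lt1 (u : T -> \bar R) : measurable_fun setT u ->
  (forall x, 0 <= u x <= 1) -> \int[mu]_x u x < 1 <-> 0 < mu [set x | u x < 1].
Proof.
move=> mu_ u01; have u0 x : 0 <= u x by case/andP: (u01 x).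
have u1 x : u x <= 1 by case/andP: (u01 x).
have ufin x : u x \is a fin_num by rewrite ge0_fin_numE// (le_lt_trans (u1 x)) ?ltry.
have mv : measurable_fun setT (fun x => 1 - u x) by exact: emeasurable_funB.
have v0 x : 0 <= 1 - u x by rewrite sube_ge0 ?u1 ?ufin ?orbT.
have : \int[mu]_x u x + \int[mu]_x (1 - u x) = 1.
  rewrite -ge0_integralD//; under eq_integral do rewrite addeC subeK//.
  by rewrite integral_cst// mul1e.
have -> : mu [set x | u x < 1] = mu (setT `&` [set x | 0 < 1 - u x]).
  by rewrite setTI; congr (mu _); apply/seteqP; split=> x /=; rewrite sube_gt0.
rewrite -integral_gt0// => uv; rewrite -[X in _ < X <-> _]uv.
have ui : \int[mu]_x u x \is a fin_num.
  rewrite ge0_fin_numE; last exact: integral_ge0.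
  apply: (@le_lt_trans _ _ 1); last exact: ltry.
  by rewrite -[leRHS]uv leeDl// integral_ge0.
by rewrite lteDl.
Qed.

(** With [p = mu U] the integral is at most [(1 - e) p + (1 - p) = 1 - e p], and [p] is at least one
    half. *)
Lemma integral_le_gap (u : T -> \bar R) (U : set T) (e : R) : measurable_fun setT u ->
  (forall x, 0 <= u x <= 1) -> measurable U -> (0 <= e <= 1)%R ->
  (forall x, U x -> u x <= (1 - e)%:E) -> 2^-1%:E <= mu U ->
  \int[mu]_x u x <= (1 - e / 2)%:E.
Proof.
move=> mu_ u01 mU /andP[e0 e1] uU halfU.
have u0 x : 0 <= u x by case/andP: (u01 x).
have u1 x : u x <= 1 by case/andP: (u01 x).
have mu1 A : measurable A -> mu A <= 1 by move=> mA; rewrite -muT le_measure ?inE.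
have e1' : (0 <= 1 - e)%R by lra.
have -> : \int[mu]_x u x = \int[mu]_(x in U) u x + \int[mu]_(x in ~` U) u x.
  rewrite -ge0_integral_setU ?setUv//; first exact: measurableC.
  by apply/disj_setPS; rewrite setICr.
have -> : (1 - e / 2)%:E = (1 - e)%:E * 1 + (e / 2)%:E.
  by rewrite mule1 -EFinD; congr (_%:E); lra.
have fU : mu U \is a fin_num by rewrite ge0_fin_numE// (le_lt_trans (mu1 _ mU)) ?ltry.
have muUC : mu (~` U) = 1 - mu U.
  have mUC := measurableC mU; rewrite -muT -(setUv U) measureU ?setICr//.
  by rewrite addeAC subee// add0e.
apply: (@le_trans _ _ ((1 - e)%:E * mu U + (1 - mu U))).
  apply: leeD.
    rewrite -integral_cst//; apply: ge0_le_integral => //.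
    exact: measurable_funTS.
  rewrite -muUC -[leRHS]mul1e -(integral_cst mu (measurableC mU)).
  apply: ge0_le_integral => //; [exact: measurableC|exact: measurable_funTS].
rewrite -(fineK fU) -!EFinM -!EFinD lee_fin.
have : (2^-1 <= fine (mu U))%R by rewrite -lee_fin fineK.
by move: (fine _) => p hp; nra.
Qed.

End ProbabilityIntegral.

Section Avoidance.
Local Open Scope ereal_scope.
Context d (S : measurableType d) (R : realType) (K : R.-pker S ~> S).
Implicit Types (T G : set S) (j : nat) (s : S).

Fixpoint reach T G j : set S :=
  if j is j'.+1 then T `|` (G `&` [set s | 0 < K s (reach T G j')]) else T.

(** The probability that the chain started at [s] is outside [T] at all times from 0 to [j]. *)
Fixpoint avoid T j s : \bar R :=
  (\1_(~` T) s)%:E * (if j is j'.+1 then \int[K s]_s' avoid T j' s' else 1).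

Lemma measurable_reach T G j : measurable T -> measurable G ->
  measurable (reach T G j).
Proof.
move=> mT mG; elim: j => [//|j IH] /=; apply: measurableU => //; apply: measurableI => //.
rewrite -[X in measurable X]setTI; apply: emeasurable_fun_o_infty => //.
exact: measurable_kernel.
Qed.

Lemma reach0 T G j : T `<=` reach T G j.
Proof. by case: j => [|j] //= s; left. Qed.

Lemma sub_reach T G i j : measurable T -> measurable G -> (i <= j)%N ->
  reach T G i `<=` reach T G j.
Proof.
move=> mT mG; elim: i j => [|i IH] [|j] // ij; try exact: reach0.
apply: setUS; apply: setIS => s /= /lt_le_trans; apply.
by apply: le_measure; rewrite ?inE; last exact: IH; exact: measurable_reach.
Qed.

(** A larger target shrinks the region allowed on the way, but a state lost from that region already
    lies in [T']. *)
Lemma reach_subset T T' j : measurable T -> measurable T' -> T `<=` T' ->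
  reach T (~` T) j `<=` reach T' (~` T') j.
Proof.
move=> mT mT' TT'; elim: j => [//|j IH] s /=; have [T's|T's] := pselect (T' s).
  by left.
case=> [/TT'//|[_ Ks]]; right; split=> //; apply: lt_le_trans Ks _.
by apply: le_measure; rewrite ?inE; last exact: IH;
  apply: measurable_reach => //; exact: measurableC.
Qed.

Lemma avoid_in T j s : T s -> avoid T j s = 0.
Proof.
by case: j => [|j] Ts /=; rewrite indicE memNset ?mul0e//= => /(_ Ts).
Qed.

Lemma avoid_out0 T s : ~ T s -> avoid T 0 s = 1.
Proof. by move=> Ts /=; rewrite indicE mem_set// mule1. Qed.

Lemma avoid_outS T j s : ~ T s -> avoid T j.+1 s = \int[K s]_s' avoid T j s'.
Proof. by move=> Ts /=; rewrite indicE mem_set// mul1e. Qed.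

Lemma avoid_ge0 T j s : 0 <= avoid T j s.
Proof.
elim: j s => [|j IH] s /=; apply: mule_ge0; rewrite ?lee_fin//.
by apply: integral_ge0 => s' _; exact: IH.
Qed.

Lemma measurable_avoid T j : measurable T -> measurable_fun setT (avoid T j).
Proof.
move=> mT; elim: j => [|j IH] /=; apply: emeasurable_funM => //;
  try exact/measurable_EFinP/measurable_indic/measurableC.
apply: (measurable_fun_integral_finite_kernel (fun z => avoid T j z.2) K).
  by move=> z; exact: avoid_ge0.
exact: measurableT_comp IH measurable_snd.
Qed.

Lemma le_integral_kernel s (f g : S -> \bar R) : measurable_fun setT f ->
  measurable_fun setT g -> (forall s', 0 <= f s' <= g s') ->
  \int[K s]_s' f s' <= \int[K s]_s' g s'.
Proof. by move=> mf mg fg; apply: ge0_le_integral => // x _; case/andP: (fg x). Qed.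

Lemma avoid_le1 T j s : measurable T -> avoid T j s <= 1.
Proof.
move=> mT; elim: j s => [|j IH] s; (have [Ts|Ts] := pselect (T s);
  first by rewrite avoid_in// lee01); rewrite ?avoid_out0 ?avoid_outS//.
apply: (@le_trans _ _ (\int[K s]_s' cst 1 s')).
  apply: le_integral_kernel => //; first exact: measurable_avoid.
  by move=> s'; rewrite avoid_ge0 IH.
by rewrite integral_cst// mul1e prob_kernel.
Qed.

Lemma avoid01 T j s : measurable T -> 0 <= avoid T j s <= 1.
Proof. by move=> mT; rewrite avoid_ge0 avoid_le1. Qed.

Lemma avoid_lt1 T j s : measurable T -> avoid T j s < 1 <-> reach T (~` T) j s.
Proof.
move=> mT; elim: j s => [|j IH] s; (have [Ts|Ts] := pselect (T s);
  first by split=> _; [exact: reach0|rewrite avoid_in// lte01]).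
  by rewrite avoid_out0// ltxx.
rewrite avoid_outS// integral_lt1; last 3 first.
- exact: prob_kernel.
- exact: measurable_avoid.
- by move=> x; exact: avoid01.
have -> : [set x | avoid T j x < 1] = reach T (~` T) j.
  by apply/seteqP; split=> x /= /IH.
by split=> [Kr|[//|[]//]]; right.
Qed.

(** Markov property at time [i]: whatever the state at that time, the next [W] steps contribute a
    factor of at most [c]. *)
Lemma avoid_markov T W i s (c : R) : measurable T -> (0 <= c)%R ->
  (forall s', avoid T W s' <= c%:E) -> avoid T (i + W) s <= c%:E * avoid T i s.
Proof.
move=> mT c0 cW; elim: i s => [|i IH] s; (have [Ts|Ts] := pselect (T s);
  first by rewrite !avoid_in// mule0).
  by rewrite avoid_out0// mule1.
rewrite addSn !avoid_outS//.
rewrite -ge0_integralZl//; last 2 first.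
- exact: measurable_avoid.
- by move=> x _; exact: avoid_ge0.
apply: le_integral_kernel; first exact: measurable_avoid.
  by apply: measurable_funeM; exact: measurable_avoid.
by move=> s'; rewrite avoid_ge0 IH.
Qed.

Lemma avoid_geometric T W i s (c : R) : measurable T -> (0 <= c)%R ->
  (forall s', avoid T W s' <= c%:E) -> avoid T (i * W) s <= (c ^+ i)%:E.
Proof.
move=> mT c0 cW; elim: i => [|i IH]; first by rewrite mul0n expr0 avoid_le1.
rewrite mulSn addnC exprS EFinM; apply: le_trans (avoid_markov _ _ mT c0 cW) _.
exact: lee_wpmul2l.
Qed.

(* Off [Q], runs almost surely avoid [Q], and hence [Z], before they hit [B]. *)
Lemma avoid_off B Z Q j s : measurable B -> measurable Z -> measurable Q ->
  Z `<=` Q -> (forall s', ~ Q s' -> ~ B s' -> K s' Q = 0) ->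
  ~ Q s -> avoid B j s <= avoid (B `|` Z) j s.
Proof.
move=> mB mZ mQ ZQ KQ; have mBZ : measurable (B `|` Z) by exact: measurableU.
elim: j s => [|j IH] s Qs; (have [Bs|Bs] := pselect (B s);
  first by rewrite [avoid B _ s]avoid_in// avoid_ge0);
  have BZs : ~ (B `|` Z) s by case=> // /ZQ.
  by rewrite !avoid_out0.
rewrite !avoid_outS//; apply: ae_ge0_le_integral => //.
- by move=> x _; exact: avoid_ge0.
- exact: measurable_avoid.
- by move=> x _; exact: avoid_ge0.
- exact: measurable_avoid.
exists Q; split=> //; first exact: KQ.
by move=> x /= xQ; apply: contrapT => Qx; apply: xQ => _; exact: IH.
Qed.

(** The probability of never entering [T], as an infimum over the horizons. *)
Definition avoid_inf T s := ereal_inf (range (fun j => avoid T j s)).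

Lemma measurable_avoid_inf T : measurable T -> measurable_fun setT (avoid_inf T).
Proof.
move=> mT; have -> : avoid_inf T = (fun x => einfs (fun j => avoid T j x) 0%N).
  apply/funext => x; rewrite /avoid_inf /einfs /sdrop; congr ereal_inf.
  by apply/seteqP; split=> y [j _ <-]; exists j.
by apply: measurable_fun_einfs => j; exact: measurable_avoid.
Qed.

Lemma avoid_inf_ge0 T s : 0 <= avoid_inf T s.
Proof. by apply: le_ereal_inf_tmp => _ [j _ <-]; exact: avoid_ge0. Qed.

Lemma avoid_inf_le T j s : avoid_inf T s <= avoid T j s.
Proof. by apply: ereal_inf_lbound; exists j. Qed.

Lemma avoid_inf_gt0 B Z i s : measurable B -> measurable Z ->
  (forall s' j, Z s' -> avoid B j s' = 1) -> reach Z (~` B) i s ->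
  0 < avoid_inf B s.
Proof.
move=> mB mZ avZ; have mu_ := measurable_avoid_inf mB; have u0 := avoid_inf_ge0 B.
elim: i s => [|i IH] s /=.
  move=> Zs; apply: (@lt_le_trans _ _ 1); first by rewrite lte_fin.
  by apply: le_ereal_inf_tmp => _ [j _ <-]; rewrite avZ.
case=> [Zs|[Bs Ks]].
  apply: (@lt_le_trans _ _ 1); first by rewrite lte_fin.
  by apply: le_ereal_inf_tmp => _ [j _ <-]; rewrite avZ.
have I0 : 0 < \int[K s]_x avoid_inf B x.
  apply/integral_gt0 => //; rewrite setTI; apply: (lt_le_trans Ks).
  apply: le_measure => //; rewrite inE; first exact/measurable_reach/measurableC.
  rewrite -[X in measurable X]setTI; exact: emeasurable_fun_o_infty.
(* Off [B], horizon 0 has value 1 and horizon [j.+1] is the integral of horizon [j], so this minimum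
   bounds every horizon from below. *)
apply: (@lt_le_trans _ _ (Order.min 1 (\int[K s]_x avoid_inf B x))).
  by rewrite lt_min I0 lte_fin ltr01.
apply: le_ereal_inf_tmp => _ [[|j] _ <-]; first by rewrite avoid_out0// ge_min lexx.
rewrite avoid_outS// ge_min; apply/orP; right; apply: le_integral_kernel => //.
  exact: measurable_avoid.
by move=> x; rewrite u0 avoid_inf_le.
Qed.

End Avoidance.

(** * From the kernel to the law of the runs *)

Section RunLaw.
Local Open Scope ereal_scope.
Context d (S : measurableType d) (R : realType) (K : R.-pker S ~> S).
Variables (mu : probability S R) (P : probability (runs S) R).
Hypothesis lawP : run_law mu K P.
Variable B : set S.
Hypothesis mB : measurable B.

Lemma measurable_coordinate (A : set S) i : measurable A ->
  measurable ([set w | A (w i)] : set (runs S)).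
Proof.
move=> mA; apply: sub_sigma_algebra; exists i => //; exists A => //.
by rewrite setTI.
Qed.

Definition avoiding j : set (runs S) := [set w | forall i, (i <= j)%N -> ~ B (w i)].

Lemma measurable_avoiding j : measurable (avoiding j).
Proof.
have -> : avoiding j = \bigcap_(i in `I_j.+1) [set w | (~` B) (w i)].
  by apply/seteqP; split=> w H i; exact: (H i).
apply: bigcap_measurable => [|i _]; first by exists 0%N.
by apply: (measurable_coordinate (A := ~` B)); exact: measurableC.
Qed.

Lemma prob_avoiding j : P (avoiding j) = \int[mu]_s avoid K B j s.
Proof.
have := lawP (A := nseq j (~` B)) (measurableC mB); rewrite size_nseq.
have -> : [set w | (~` B) (w 0%N) /\
    forall i, (i < j)%N -> nth setT (nseq j (~` B)) i (w i.+1)] = avoiding j.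
  apply/seteqP; split=> w /=.
    move=> [B0 H] [|i]//= ij; have := H i ij; by rewrite nth_nseq ij.
  by move=> H; split=> [|i ij]; [exact: (H 0%N)|rewrite nth_nseq ij; exact: H].
move=> ->; last first.
  by move=> i; rewrite nth_nseq; case: ifP => // _; exact: measurableC.
rewrite integral_mkcond; apply: eq_integral => s _; rewrite patchE.
elim: j s => [|j IH] s; have [Bs|Bs] := pselect (B s).
- by rewrite avoid_in// memNset//= => /(_ Bs).
- by rewrite avoid_out0// mem_set.
- by rewrite avoid_in// memNset//= => /(_ Bs).
rewrite avoid_outS// mem_set//=; rewrite integral_mkcond.
by apply: eq_integral => s' _; rewrite -IH patchE.
Qed.

Lemma measurable_eventually_in : measurable (eventually_in B).
Proof.
have -> : eventually_in B = \bigcup_i [set w | B (w i)].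
  by apply/seteqP; split=> w [i]; [exists i|move=> _ Bi; exists i].
by apply: bigcup_measurable => i _; exact: measurable_coordinate.
Qed.

Lemma eventually_inC : ~` eventually_in B = \bigcap_j avoiding j.
Proof.
apply/seteqP; split=> w /=; first by move=> nB j _ i _ Bi; apply: nB; exists i.
by move=> H [i Bi]; exact: (H i I i (leqnn i)).
Qed.

Lemma prob_eventually_inC : P (~` eventually_in B) =
  ereal_inf (range (fun j => \int[mu]_s avoid K B j s)).
Proof.
have nd : nonincreasing_seq avoiding.
  move=> i j ij; apply/subsetPset => w H l li; apply: H; exact: leq_trans ij.
have cv : P \o avoiding @ \oo --> P (\bigcap_j avoiding j).
  apply: nonincreasing_cvg_mu => //.
  - by rewrite (le_lt_trans (probability_le1 _ _)) ?ltry//; exact: measurable_avoiding.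
  - exact: measurable_avoiding.
  - by apply: bigcap_measurable => [|i _]; [exists 0%N|exact: measurable_avoiding].
have -> : (fun j => \int[mu]_s avoid K B j s) = P \o avoiding.
  by apply/funext => j /=; rewrite prob_avoiding.
rewrite eventually_inC -(cvg_lim _ cv)//; apply/cvg_lim => //.
apply: ereal_nonincreasing_cvgn => i j ij /=.
by apply: le_measure; rewrite ?inE; last exact/subsetPset/nd; exact: measurable_avoiding.
Qed.

(** An infimum of numbers at most 1 equals 1 iff none of them is smaller, and at horizon [j] this
    means that the set [reach] at [j] is null. *)
Lemma prob_eventually_in_0 N :
  (forall j, reach K B (~` B) j `<=` reach K B (~` B) N) ->
  P (eventually_in B) = 0 <-> ~ 0 < mu (reach K B (~` B) N).
Proof.
move=> stable; have mC := measurableC mB.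
have -> : P (eventually_in B) = 0 <-> P (~` eventually_in B) = 1.
  have mE := measurable_eventually_in; rewrite probability_setC//.
  have := fin_num_measure P _ mE; case: (P _) => // p _; rewrite -EFinB.
  by split=> -[e]; congr (_%:E); lra.
have le1 j : \int[mu]_s avoid K B j s <= 1.
  rewrite -prob_avoiding; apply: probability_le1; exact: measurable_avoiding.
have lt1 j : \int[mu]_s avoid K B j s < 1 <-> 0 < mu (reach K B (~` B) j).
  rewrite integral_lt1.
  - suff -> : [set x | avoid K B j x < 1] = reach K B (~` B) j by [].
    by apply/seteqP; split=> x /avoid_lt1; exact.
  - exact: probability_setT.
  - exact: measurable_avoid.
  - by move=> x; exact: avoid01.
rewrite prob_eventually_inC; split=> [inf1 /lt1|N0].
  apply/negP; rewrite -leNgt -inf1; apply: ereal_inf_lbound; exists N => //.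
apply/eqP; rewrite eq_le; apply/andP; split.
  by apply: le_trans (ereal_inf_lbound _) (le1 0%N); exists 0%N.
apply: le_ereal_inf_tmp => _ [j _ <-]; rewrite leNgt; apply/negP => /lt1 j0.
apply: N0; apply: lt_le_trans j0 _.
by apply: le_measure; rewrite ?inE; last exact: stable; exact: measurable_reach.
Qed.

(** If [Q] has positive mass, the integral of [avoid_inf] is positive and bounds all horizons from
    below. If [Q] is null, almost every run starts off [Q], where missing [B] is no likelier than
    missing the union of [B] and [Z], and this probability decays geometrically. *)
Lemma prob_eventually_in_1 N W (c : R) (Z := ~` reach K B (~` B) N)
    (Q := reach K Z (~` B) N) :
  (forall j, reach K B (~` B) j `<=` reach K B (~` B) N) ->
  (forall j, reach K Z (~` B) j `<=` Q) ->
  (0 <= c < 1)%R -> (forall s, avoid K (B `|` Z) W s <= c%:E) ->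
  P (eventually_in B) = 1 <-> ~ 0 < mu Q.
Proof.
move=> stableP stableQ /andP[c0 c1] contract; have mC := measurableC mB.
have mZ : measurable Z by apply: measurableC; exact: measurable_reach.
have mQ : measurable Q by exact: measurable_reach.
have mBZ : measurable (B `|` Z) by exact: measurableU.
have -> : P (eventually_in B) = 1 <-> P (~` eventually_in B) = 0.
  have mE := measurable_eventually_in; rewrite probability_setC//.
  have := fin_num_measure P _ mE; case: (P _) => // p _; rewrite -EFinB.
  by split=> -[e]; congr (_%:E); lra.
rewrite prob_eventually_inC; split=> [inf0 Q0|/negP].
  have avZ s j : Z s -> avoid K B j s = 1.
    move=> Zs; apply/eqP; rewrite eq_le avoid_le1//= leNgt; apply/negP.
    by move=> /(avoid_lt1 K j s mB)/stableP.
  have I0 : 0 < \int[mu]_s avoid_inf K B s.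
    apply/integral_gt0 => //; first exact: measurable_avoid_inf.
      by move=> s _; exact: avoid_inf_ge0.
    rewrite setTI; apply: lt_le_trans Q0 _; apply: le_measure; rewrite ?inE//.
      rewrite -[X in measurable X]setTI; apply: emeasurable_fun_o_infty => //.
      exact: measurable_avoid_inf.
    by move=> s; apply: avoid_inf_gt0.
  suff : 0 < (0 : \bar R) by rewrite ltxx.
  rewrite -[ltRHS]inf0; apply: lt_le_trans I0 _.
  apply: le_ereal_inf_tmp => _ [j _ <-]; apply: ge0_le_integral => //.
  - by move=> s _; exact: avoid_inf_ge0.
  - exact: measurable_avoid_inf.
  - exact: measurable_avoid.
  - by move=> s _; exact: avoid_inf_le.
rewrite -leNgt => Q0; have {}Q0 : mu Q = 0 by apply/eqP; rewrite eq_le Q0 measure_ge0.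
(* A state off [Q] and [B] with a positive chance of entering [Q] would lie in the iterate [N.+1],
   which stability puts inside [Q]. *)
have KQ s : ~ Q s -> ~ B s -> K s Q = 0.
  move=> Qs Bs; apply/eqP; rewrite eq_le measure_ge0 andbT leNgt; apply/negP => KsQ.
  by apply: Qs; apply: (stableQ N.+1); right; split.
(* The geometric bound is available at multiples of [W], which is enough for an infimum. *)
have le_geo i : ereal_inf (range (fun j => \int[mu]_s avoid K B j s)) <= (c ^+ i)%:E.
  apply: (@le_trans _ _ (\int[mu]_s avoid K B (i * W) s)).
    by apply: ereal_inf_lbound; exists (i * W)%N.
  have -> : (c ^+ i)%:E = \int[mu]_s cst (c ^+ i)%:E s.
    by rewrite integral_cst//= probability_setT mule1.
  apply: ae_ge0_le_integral => //.
  - by move=> s _; exact: avoid_ge0.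
  - exact: measurable_avoid.
  - by move=> s _; rewrite /= lee_fin exprn_ge0.
  exists Q; split=> // s /= h; apply: contrapT => Qs; apply: h => _.
  apply: le_trans (avoid_off (K := K) (i * W)%N mB mZ mQ (@reach0 _ _ _ _ _ _ _) KQ Qs) _.
  exact: avoid_geometric.
apply/eqP; rewrite eq_le; apply/andP; split; last first.
  apply: le_ereal_inf_tmp => _ [j _ <-].
  by apply: integral_ge0 => s _; exact: avoid_ge0.
apply/lee_addgt0Pr => e e0; rewrite add0e.
have cc : (fun i => c ^+ i)%R @ \oo --> (0 : R)%R.
  by apply: cvg_expr; rewrite ger0_norm.
have /cvgrPdist_lt/(_ e e0)[i _ /(_ i (leqnn i))] := cc.
rewrite sub0r normrN ger0_norm ?exprn_ge0// => ce.
by apply: le_trans (le_geo i) _; rewrite lee_fin ltW.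
Qed.

End RunLaw.

(** * Cycle-reset systems *)

Section CycleReset.
Variables (R : realType) (k m n : nat) (H : stochastic_hybrid_system R k m n).
Local Notation V := (n.-tuple R).
Local Notation S := (state R k n).
Implicit Types (e : edge k m) (l : location k) (X Y : set S) (s : S).

Definition weak e := (e \in edges H) && `[< ~ strongly_reset H e >].

Definition weak_step l l' := [exists e, [&& weak e, source e == l & target e == l']].

(** A potential that strictly decreases along weak edges. A location counts itself, so the values
    lie between 1 and [k+1]. *)
Definition rank l := #|[set l' | connect weak_step l l']%SET|.

Lemma rank_gt0 l : (0 < rank l)%N.
Proof. by apply/card_gt0P; exists l; rewrite inE connect0. Qed.

Lemma rank_le l : (rank l <= k.+1)%N.
Proof. by rewrite -[leqRHS]card_ord; exact: max_card. Qed.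

(** The last clause leaves both end edges free, so that one and the same edge can close the path
    into a cycle. *)
Lemma weak_path_edges l p : path weak_step l p -> exists c : seq (edge k m),
  [/\ all weak c, [seq source e | e <- c] = belast l p
    & forall e e', target e = l -> source e' = last l p ->
        path (fun e e' => target e == source e') e (rcons c e')].
Proof.
elim: p l => [|l' p IH] l /=.
  by move=> _; exists [::]; split=> // e e' /= -> ->; rewrite eqxx.
move=> /andP[/existsP[e1 /and3P[we1 /eqP e1l /eqP e1l']] /IH[c [wc sc pc]]].
exists (e1 :: c); split=> /=; [by rewrite we1|by rewrite e1l sc|].
by move=> e e' el e'l; rewrite el e1l eqxx /=; exact: pc.
Qed.

(** Otherwise a weak path leads from the target back to the source; made simple and closed by [e],
    it is a simple cycle without a strongly reset edge. *)
Lemma weak_step_rank e : cycle_reset H -> weak e -> (rank (target e) < rank (source e))%N.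
Proof.
move=> cr we; apply: proper_card; apply/properP; split.
  apply/fintype.subsetP => l; rewrite !inE; apply: connect_trans.
  by apply: connect1; apply/existsP; exists e; rewrite we !eqxx.
exists (source e); rewrite !inE ?connect0//; apply/negP => /connectP[p0 pp0 lp0].
case/shortenP: pp0 lp0 => p pp up _ lp.
have [c [wc sc pc]] := weak_path_edges pp.
have [] := cr (e :: c).
  split=> //.
  - move=> e'; rewrite inE => /orP[/eqP ->|/(allP wc)]; last by case/andP.
    by case/andP: we.
  - by rewrite /=; exact: pc.
  - move: up; rewrite lastI -lp rcons_uniq => /andP[nin ub] /=.
    by rewrite sc nin ub.
move=> e' ein str; have : weak e' by move: ein; rewrite inE => /orP[/eqP ->//|/(allP wc)].
by case/andP => _ /asboolP.
Qed.

Definition section X l : set V := [set v | X (l, v)].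

Lemma measurable_section X l : measurable X -> measurable (section X l).
Proof.
move=> mX; have -> : section X l = xsection X l.
  by apply/seteqP; split=> v; rewrite /xsection /= inE.
exact: measurable_xsection.
Qed.

Local Open Scope ereal_scope.

Definition hits s X (tau : R) := exists e, [/\ e \in edges H, source e = s.1,
  enabled H e (elapse H s tau)
  & 0 < reset_law H e (flow H s.1 s.2 tau) (section X (target e))].

Lemma kappa_integrandE s X tau : measurable X -> kappa_integrand H s X tau =
  \sum_(e in edges H | source e == s.1) (edge_law H (elapse H s tau) e)%:E *
     reset_law H e (flow H s.1 s.2 tau) (section X (target e)).
Proof.
move=> mX; apply: eq_bigr => e _; congr (_ * _).
by rewrite -[section X _]setIT -integral_indic//; exact: measurable_section.
Qed.

Lemma kappa_integrand_gt0 s X tau : measurable X ->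
  0 < kappa_integrand H s X tau <-> hits s X tau.
Proof.
move=> mX; rewrite kappa_integrandE//.
have t0 e : e \in edges H -> 0 <= (edge_law H (elapse H s tau) e)%:E *
    reset_law H e (flow H s.1 s.2 tau) (section X (target e)).
  by move=> eH; apply: mule_ge0 => //; rewrite lee_fin edge_law_ge0.
split=> [|[e [eH es en q0]]].
  apply: contraPP => nh; rewrite big1 ?ltxx// => e /andP[eH /eqP es].
  apply/eqP; rewrite eq_le t0// andbT leNgt; apply/negP => pq.
  apply: nh; exists e; split=> //.
    apply/edge_law_gt0 => //; rewrite lt_neqAle edge_law_ge0// andbT eq_sym.
    by apply/eqP => p0; move: pq; rewrite p0 mul0e ltxx.
  by rewrite lt_neqAle measure_ge0 andbT eq_sym; apply/eqP => q0; move: pq; rewrite q0 mule0 ltxx.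
have : 0 < (edge_law H (elapse H s tau) e)%:E *
    reset_law H e (flow H s.1 s.2 tau) (section X (target e)).
  by apply: mule_gt0 => //; rewrite lte_fin; apply/edge_law_gt0.
move=> /lt_le_trans; apply; rewrite (bigD1 e) ?eH ?es ?eqxx//=; apply: leeDl.
by apply: sume_ge0 => e' /andP[/andP[e'H _] _]; exact: t0.
Qed.

Local Notation nonneg := [set tau : R | (0 <= tau)%R].

Lemma delays_ge0 s : delays H s `<=` nonneg.
Proof. by move=> tau [e _ [s' [s1 [[]]]]]. Qed.

Lemma measurable_nonneg : measurable (nonneg : set R).
Proof.
have -> : nonneg = [set` `[0%R, +oo[] by apply/seteqP; split=> x; rewrite /= in_itv/= andbT.
exact: measurable_itv.
Qed.

Variable K : R.-pker S ~> S.
Hypothesis HK : induces H K.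

Lemma kernel_gt0 s X : measurable X ->
  measurable (delays H s `&` hits s X) /\
  (0 < K s X <-> 0 < delay_law H s (delays H s `&` hits s X)).
Proof.
move=> mX; have [mf ->] := HK s mX; have [mD D1] := delay_law_supp H s.
have mN := measurable_nonneg.
have hitsE : hits s X = [set tau | 0 < kappa_integrand H s X tau].
  by apply/seteqP; split=> tau /(kappa_integrand_gt0 s tau mX).
have mH : measurable (nonneg `&` hits s X).
  by rewrite hitsE; exact: emeasurable_fun_o_infty.
(* Measurability of [hits] is available on nonnegative times, and all delays are nonnegative. *)
have DNH : delays H s `&` hits s X = delays H s `&` (nonneg `&` hits s X).
  by rewrite setIA; congr (_ `&` _); apply/esym/setIidPl/delays_ge0.
have mDH : measurable (delays H s `&` hits s X) by rewrite DNH; exact: measurableI.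
split=> //; rewrite /kappa integral_gt0//; last first.
  move=> tau _; apply: sume_ge0 => e /andP[eH _]; apply: mule_ge0.
    by rewrite lee_fin edge_law_ge0.
  by apply: integral_ge0 => v _; rewrite lee_fin.
by rewrite -hitsE DNH (probability_supportI mD D1 mH).
Qed.

Lemma eq_kernel_gt0 s X Y : measurable X -> measurable Y ->
  (forall tau, hits s X tau <-> hits s Y tau) -> 0 < K s X <-> 0 < K s Y.
Proof.
move=> mX mY XY; rewrite (kernel_gt0 s mX).2 (kernel_gt0 s mY).2.
by have -> : hits s X = hits s Y by apply/seteqP; split=> tau /XY.
Qed.

(* For a strongly reset edge this does not depend on the point of the guard. *)
Definition refreshes e X := exists2 v, guard H e v & 0 < reset_law H e v (section X (target e)).

Lemma strongly_reset_law e v v' X : measurable X -> strongly_reset H e ->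
  guard H e v -> guard H e v' ->
  reset_law H e v (section X (target e)) = reset_law H e v' (section X (target e)).
Proof.
move=> mX [A [eta [_ str]]] gv gv'; have mXe := measurable_section (target e) mX.
by rewrite (str v gv).2// (str v' gv').2.
Qed.

(** Isolates what depends on [X] alone: given that it is enabled, a strongly reset edge contributes
    the state-independent condition [refreshes]. *)
Lemma hits_strong s X tau : measurable X -> hits s X tau <->
  exists e, [/\ e \in edges H, source e = s.1, enabled H e (elapse H s tau)
  & (strongly_reset H e /\ refreshes e X) \/
    (~ strongly_reset H e /\
     0 < reset_law H e (flow H s.1 s.2 tau) (section X (target e)))].
Proof.
move=> mX; split=> -[e [eH es en]].
  exists e; split=> //; have [str|nstr] := pselect (strongly_reset H e); last by right.
  left; split=> //; exists (flow H s.1 s.2 tau) => //.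
  by move: en => [s' [_ []]].
case=> [[str [v gv rv]]|[nstr q]]; exists e; split=> //.
rewrite (strongly_reset_law mX str _ gv)//.
by move: en => [s' [_ []]].
Qed.

Hypothesis cr : cycle_reset H.

(** * Stabilisation of the backward iteration *)

Section Stabilisation.
Variables T G : set S.
Hypotheses (mT : measurable T) (mG : measurable G).
Local Notation X := (reach K T G).

Let mX i : measurable (X i). Proof. exact: measurable_reach. Qed.

(** Induction on the rank. The strongly reset edges contribute the same throughout the window by
    assumption; a weak edge leads to a smaller rank, where membership has settled one step
    earlier. *)
Lemma reach_window a b : (forall i e, (a <= i <= b)%N -> e \in edges H ->
    strongly_reset H e -> (refreshes e (X i) <-> refreshes e (X a))) ->
  forall r i s, (rank s.1 <= r)%N -> (a + r <= i <= b)%N -> X i s <-> X i.+1 s.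
Proof.
move=> const; elim=> [|r IH] i s rs; first by have := rank_gt0 s.1; lia.
case: i => [|i] ib; first by lia.
have Kiff : 0 < K s (X i) <-> 0 < K s (X i.+1).
  apply: eq_kernel_gt0; [exact: mX|exact: mX|move=> tau].
  rewrite (hits_strong _ _ (mX i)) (hits_strong _ _ (mX i.+1)).
  split=> -[e [eH es en he]]; exists e; split=> //; case: he => -[str h].
  - left; split=> //; apply/(const i.+1) => //; first by lia.
    by apply/(const i) => //; lia.
  - have we : weak e by rewrite /weak eH; exact/asboolP.
    have XX v : X i (target e, v) <-> X i.+1 (target e, v).
      by apply: IH => /=; [have := weak_step_rank cr we; rewrite es; lia|lia].
    right; split=> //.
    suff <- : section (X i) (target e) = section (X i.+1) (target e) by [].
    by apply/seteqP; split=> v /XX.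
  - left; split=> //; apply/(const i) => //; first by lia.
    by apply/(const i.+1) => //; lia.
  - have we : weak e by rewrite /weak eH; exact/asboolP.
    have XX v : X i (target e, v) <-> X i.+1 (target e, v).
      by apply: IH => /=; [have := weak_step_rank cr we; rewrite es; lia|lia].
    right; split=> //.
    suff -> : section (X i) (target e) = section (X i.+1) (target e) by [].
    by apply/seteqP; split=> v /XX.
by split=> -[Ts|[Gs Ks]]; [left|right; split=> //; exact/Kiff|left|right; split=> //;
  exact/Kiff].
Qed.

Let fresh i := [set e in edges H | `[< strongly_reset H e /\ refreshes e (X i) >]]%SET.

Let fresh_sub i j : (i <= j)%N -> fresh i \subset fresh j.
Proof.
move=> ij; apply/fintype.subsetP => e; rewrite !inE => /andP[-> /asboolP[str [v gv rv]]] /=.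
apply/asboolP; split=> //; exists v => //; apply: lt_le_trans rv _.
apply: le_measure; rewrite ?inE; do ?by apply: measurable_section; exact: mX.
by move=> w; exact: sub_reach.
Qed.

Lemma reach_stable j : X j `<=` X (#|edges H|.+1 * k.+1)%N.
Proof.
(* Pigeonhole: the sets [fresh] sampled at multiples of [k+1] increase, and at most [#|edges H|] of
   these increases are strict. *)
have [q qE qq] : exists2 q, (q <= #|edges H|)%N &
    fresh (q * k.+1) = fresh (q.+1 * k.+1).
  apply: contrapT => nq.
  suff h q : (q <= #|edges H|.+1)%N -> (q <= #|fresh (q * k.+1)|)%N.
    have := h _ (leqnn _); rewrite leqNgt ltnS subset_leq_card//.
    by apply/fintype.subsetP => e; rewrite inE => /andP[].
  elim: q => // q IH qE; apply: leq_ltn_trans (IH (ltnW qE)) _.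
  apply: proper_card; rewrite finset.properEneq fresh_sub ?andbT; last first.
    by rewrite leq_mul2r leqnSn orbT.
  by apply/eqP => e; apply: nq; exists q.
pose a := (q * k.+1)%N; pose b := (q.+1 * k.+1)%N.
(* By monotonicity [fresh] is constant from [a] to [b], and the window length [k+1] bounds every
   rank; so the iteration has reached a fixed point at [b]. *)
have stab s : X b s <-> X b.+1 s.
  apply: (@reach_window a b _ k.+1) => [i e /andP[ai ib] eH str||].
  - have ei i' : refreshes e (X i') <-> e \in fresh i'.
      rewrite inE eH /=; split=> [r|/asboolP[]//]; exact/asboolP.
    suff fia : fresh i = fresh a by rewrite !ei fia.
    apply/eqP; rewrite finset.eqEsubset [X in _ && X]fresh_sub ?andbT//.
    by rewrite [fresh a]qq fresh_sub.
  - exact: rank_le.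
  - by rewrite /a /b mulSn; lia.
have fix_b i : (b <= i)%N -> X i `<=` X b.
  elim: i => [|i IH]; first by rewrite leqn0 => /eqP ->.
  rewrite leq_eqVlt => /orP[/eqP <-//|bi] s.
  have Xib : X i = X b.
    by apply/seteqP; split; [exact: IH|exact: sub_reach].
  by rewrite [X _]/= Xib => Xs; apply/stab.
have bN : (b <= #|edges H|.+1 * k.+1)%N by rewrite leq_mul2r ltnS qE orbT.
apply: (@subset_trans _ (X b)); last exact: sub_reach.
by case: (leqP j b) => [jb|/ltnW/fix_b//]; exact: sub_reach.
Qed.

End Stabilisation.

Lemma avoid_antitone T i j s : measurable T -> (i <= j)%N -> avoid K T j s <= avoid K T i s.
Proof.
move=> mT; elim: i j s => [|i IH] [|j] s // ij; (have [Ts|Ts] := pselect (T s);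
  first by rewrite !avoid_in).
  by rewrite [leRHS]avoid_out0// avoid_le1.
rewrite !avoid_outS//; apply: le_integral_kernel; do ?exact: measurable_avoid.
by move=> s'; rewrite avoid_ge0 IH.
Qed.

Lemma kernel_half s U : measurable U ->
  (forall e v, e \in edges H -> source e = s.1 -> guard H e v ->
     2^-1%:E <= reset_law H e v (section U (target e))) ->
  2^-1%:E <= K s U.
Proof.
move=> mU halfU; have [mf ->] := HK s mU; have [mD D1] := delay_law_supp H s.
have mN := measurable_nonneg.
have k0 tau : 0 <= kappa_integrand H s U tau.
  apply: sume_ge0 => e /andP[eH _]; apply: mule_ge0; first by rewrite lee_fin edge_law_ge0.
  by apply: integral_ge0 => v _; rewrite lee_fin.
apply: (@le_trans _ _ (\int[delay_law H s]_(tau in delays H s) kappa_integrand H s U tau));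
  last by apply: ge0_subset_integral => //; exact: delays_ge0.
rewrite -[leLHS]mule1 -D1 -integral_cst//; apply: ge0_le_integral => //.
- by move=> tau _; rewrite lee_fin invr_ge0.
- by apply: measurable_funS mf => //; exact: delays_ge0.
move=> tau [e0 e0H [s' [s1 [[t0 inv ->] sw]]]]; rewrite kappa_integrandE//.
have en0 : exists e, enabled H e (elapse H s tau) by exists e0, s'.
pose p e := edge_law H (elapse H s tau) e.
(* Enabled edges all leave the location of [s], so the restricted sum still has total 1. *)
have psum : \sum_(e in edges H | source e == s.1) (p e)%:E = 1.
  rewrite sumEFin -(edge_law_sum en0); congr (_%:E).
  rewrite [RHS](bigID (fun e => source e == s.1))/= [X in (_ = _ + X)%R]big1 ?addr0//.
  move=> e /andP[eH es]; apply/eqP; rewrite eq_le edge_law_ge0// andbT leNgt.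
  apply/negP => /(edge_law_gt0 _ eH)[s2 [[_ ee _] _]].
  by move: es; rewrite -ee eqxx.
rewrite /cst -[leLHS]mule1 -psum ge0_sume_distrr; last first.
  by move=> e /andP[eH _]; rewrite lee_fin edge_law_ge0.
apply: lee_sum => e /andP[eH /eqP es]; rewrite muleC -/(p e).
have [->|p0] := eqVneq (p e) 0%R; first by rewrite !mul0e.
apply: lee_wpmul2l; first by rewrite lee_fin edge_law_ge0.
apply: halfU => //.
have : (0 < p e)%R by rewrite lt_neqAle eq_sym p0 edge_law_ge0.
by move=> /(edge_law_gt0 _ eH)[s2 [_ []]].
Qed.

(** When avoidance is below 1 everywhere, these sets increase to the whole space, so any fixed law
    eventually gives them half of its mass. *)
Definition avoid_gap T N i := [set s | avoid K T N s <= (1 - i.+1%:R^-1)%:E].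

Lemma measurable_avoid_gap T N i : measurable T -> measurable (avoid_gap T N i).
Proof.
move=> mT; rewrite -[avoid_gap _ _ _]setTI; apply: emeasurable_fun_infty_c => //.
exact: measurable_avoid.
Qed.

Lemma sub_avoid_gap T N i j : (i <= j)%N -> avoid_gap T N i `<=` avoid_gap T N j.
Proof.
move=> ij s /= /le_trans; apply; rewrite lee_fin lerD2l lerN2.
by rewrite lef_pV2 ?posrE ?ltr0n// ler_nat.
Qed.

(** Continuity from below for the law at one point of the guard; strong reset makes the index
    obtained valid at all of its points. *)
Lemma strong_uniform T N e : measurable T -> (forall s, avoid K T N s < 1) ->
  strongly_reset H e -> exists i0, forall i v, (i0 <= i)%N -> guard H e v ->
    2^-1%:E <= reset_law H e v (section (avoid_gap T N i) (target e)).
Proof.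
move=> mT lt1 str; have [[v0 gv0]|ng] := pselect (exists v, guard H e v); last first.
  by exists 0%N => i v _ gv; case: ng; exists v.
pose F i := section (avoid_gap T N i) (target e).
have mF i : measurable (F i) by apply: measurable_section; exact: measurable_avoid_gap.
have UF : \bigcup_i F i = setT.
  apply/seteqP; split=> // v _; have a1 := lt1 (target e, v).
  have := avoid_ge0 K T N (target e, v).
  case E : (avoid K T N (target e, v)) a1 => [x| |]//; rewrite lte_fin => x1 _.
  have [i xi] := ltr_add_invr x1; exists i => //; rewrite /F /section /avoid_gap /= E lee_fin.
  by rewrite lerBrDr ltW.
have cv : reset_law H e v0 \o F @ \oo --> reset_law H e v0 (\bigcup_i F i).
  apply: nondecreasing_cvg_mu => //; first by rewrite UF.
  move=> i j ij; apply/subsetPset => v; exact: sub_avoid_gap.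
rewrite UF probability_setT in cv.
have half1 : 2^-1%:E < 1 :> \bar R by rewrite lte_fin invf_lt1// ltr1n.
have [i0 _ hi0] : \forall i \near \oo, 2^-1%:E < (reset_law H e v0 \o F) i.
  apply: (cv [set y | 2^-1%:E < y]); apply: open_nbhs_nbhs; split; last exact: half1.
  exact: open_ereal_gt_ereal.
exists i0 => i v i0i gv; rewrite (strongly_reset_law _ str gv gv0).
  by apply/ltW; exact: hi0.
exact: measurable_avoid_gap.
Qed.

Lemma avoid_contract T N : measurable T -> (forall s, avoid K T N s < 1) ->
  exists W (c : R), (0 <= c < 1)%R /\ forall s, avoid K T W s <= c%:E.
Proof.
move=> mT lt1.
have [i hi] : exists i, forall e v, e \in edges H -> strongly_reset H e -> guard H e v ->
    2^-1%:E <= reset_law H e v (section (avoid_gap T N i) (target e)).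
  (* Asking for all indices from [i0] on lets finitely many edges be combined by a maximum. *)
  suff [i hi] : exists i0, forall i, (i0 <= i)%N -> forall e v, e \in enum (edges H) ->
      strongly_reset H e -> guard H e v ->
      2^-1%:E <= reset_law H e v (section (avoid_gap T N i) (target e)).
    by exists i => e v eH; apply: hi => //; rewrite mem_enum.
  elim: (enum _) => [|e es [i1 hi1]]; first by exists 0%N.
  have [str|nstr] := pselect (strongly_reset H e); last first.
    exists i1 => i i1i e' v; rewrite inE => /orP[/eqP ->|] //.
    exact: hi1.
  have [i2 hi2] := strong_uniform mT lt1 str.
  exists (maxn i1 i2) => i; rewrite geq_max => /andP[i1i i2i] e' v.
  by rewrite inE => /orP[/eqP -> _|]; [exact: hi2|exact: hi1].
pose eps : R := (i.+1%:R^-1)%R.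
have eps0 : (0 < eps)%R by rewrite invr_gt0 ltr0n.
have eps1 : (eps <= 1)%R by rewrite invf_le1 ?ltr0n// ler1n.
have gapE : avoid_gap T N i = [set s | avoid K T N s <= (1 - eps)%:E] by [].
have epsr r : (0 < eps / 2 ^+ r <= eps)%R.
  rewrite divr_gt0 ?exprn_gt0//= ler_pdivrMr ?exprn_gt0// ler_peMr ?(ltW eps0)//.
  by rewrite exprn_ege1// ler1n.
(* Each unit of rank costs one more step of horizon and a factor of 2 in the gap; rank 0 does not
   occur. *)
suff h r s : (rank s.1 <= r)%N -> avoid K T (N + r) s <= (1 - eps / 2 ^+ r)%:E.
  exists (N + k.+1)%N, (1 - eps / 2 ^+ k.+1)%R; split.
    by have := epsr k.+1; move: (eps / _)%R => x; lra.
  by move=> s; apply: h; exact: rank_le.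
elim: r s => [|r IH] s rs; first by have := rank_gt0 s.1; lia.
have [Ts|Ts] := pselect (T s).
  by rewrite avoid_in// lee_fin; have := epsr r.+1; move: (eps / _)%R => x; lra.
rewrite addnS avoid_outS//.
have -> : (eps / 2 ^+ r.+1 = (eps / 2 ^+ r) / 2)%R.
  by rewrite exprSr invfM mulrA.
have [er0 er1] := andP (epsr r).
(* From rank at most [r.+1], one step enters [U] with probability at least one half: strongly reset
   edges through the gap set, weak edges because the rank drops. *)
pose U := avoid_gap T N i `|` [set s | (rank s.1 <= r)%N].
have mU : measurable U.
  apply: measurableU; first exact: measurable_avoid_gap.
  have -> : [set s : S | (rank s.1 <= r)%N] = [set l | (rank l <= r)%N] `*` setT.
    by apply/seteqP; split=> -[l v] //= [].
  exact: measurableX.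
apply: (@integral_le_gap _ _ _ _ _ _ U) => //.
- exact: prob_kernel.
- exact: measurable_avoid.
- by move=> x; exact: avoid01.
- by rewrite (ltW er0) (le_trans er1).
- move=> x [gx|rx]; last exact: IH.
  apply: le_trans (avoid_antitone _ mT (leq_addr r N)) _.
  by apply: le_trans gx _; rewrite lee_fin lerD2l lerN2.
apply: kernel_half => // e v eH es gv.
have [str|nstr] := pselect (strongly_reset H e).
  apply: le_trans (hi e v eH str gv) _; apply: le_measure; rewrite ?inE.
  - by apply: measurable_section; exact: measurable_avoid_gap.
  - exact: measurable_section.
  - by move=> w; left.
have -> : section U (target e) = setT.
  apply/seteqP; split=> // w _; right => /=.
  have we : weak e by rewrite /weak eH; exact/asboolP.
  by have := weak_step_rank cr we; rewrite es; lia.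
by rewrite probability_setT lee_fin invf_le1// ler1n.
Qed.

End CycleReset.

(** * Positive probability as a first-order condition *)

Section DiscreteLaws.
Context (T : choiceType) (R : realType).
Local Open Scope ereal_scope.

Lemma counting_gt0 (X : set T) : finite_set X ->
  0 < (counting X : \bar R) <-> X !=set0.
Proof.
move=> fX; rewrite /counting asboolT// lte_fin ltr0n finmap.cardfs_gt0.
split=> [/finmap.fset0Pn[x]|[x Xx]]; first by rewrite in_fset_set// => /set_mem; exists x.
by apply/finmap.fset0Pn; exists x; rewrite in_fset_set//; exact/mem_set.
Qed.

Lemma discrete_uniform_gt0 (A X : set T) : finite_set A -> X `<=` A ->
  0 < discrete_uniform R A X <-> X !=set0.
Proof.
move=> fA XA; have fX := sub_finite_set XA fA.
have -> : X !=set0 <-> 0 < (counting X : \bar R) by rewrite counting_gt0.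
rewrite /discrete_uniform (setIidr XA) lte_fin.
have fin (B : set T) : finite_set B -> (counting B : \bar R) = (fine (counting B : \bar R))%:E.
  by move=> fB; rewrite /counting asboolT.
rewrite (fin X fX) lte_fin /=; split=> [|X0].
  apply: contraTT; rewrite -!leNgt => h.
  have -> : fine (counting X : \bar R) = 0%R.
    apply/eqP; rewrite eq_le h /=; rewrite /counting asboolT//.
  by rewrite mul0r.
apply: divr_gt0 => //; rewrite -lte_fin -fin//; apply/counting_gt0 => //.
have /(counting_gt0 fX)[x Xx] : 0 < (counting X : \bar R) by rewrite fin// lte_fin.
by exists x; exact: XA.
Qed.

End DiscreteLaws.

Section Predecessors.
Variables (R : realType) (k m n : nat) (H : stochastic_hybrid_system R k m n).
Local Notation V := (n.-tuple R).
Local Notation S := (state R k n).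
Implicit Types (e : edge k m) (l : location k) (X Y D : set S) (s : S) (w : V).

(** Under the reset condition a definable reset set that is not [many] is finite, so the second
    disjunct is the discrete case. *)
Definition positive_reset e w (A : set V) :=
  many (reset H e w `&` A) \/ ~ many (reset H e w) /\ reset H e w `&` A !=set0.

Definition good_delays s X : set R := [set tau | exists e,
  [/\ e \in edges H, source e = s.1, delays_edge H s e tau
    & positive_reset e (flow H s.1 s.2 tau) (section X (target e))]].

Definition pre X : set S := [set s | many1 (good_delays s X) \/
  ~ many1 (delays H s) /\ good_delays s X !=set0].

Lemma finite_many_nonempty (A X : set V) : finite_set A -> many A -> X !=set0 -> many X.
Proof.
move=> fA /(finite_many fA) n0; move: X {A fA}; rewrite n0 => X [v] /=.
by rewrite (tuple0 v).
Qed.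

Lemma positive_resetP e w (A : set V) : e \in edges H -> reset_condition H ->
  measurable A -> tame (reset H e w) -> tame (reset H e w `&` A) ->
  positive_reset e w A <-> (0 < reset_law H e w A)%E.
Proof.
move=> eH rc mA tr trA; have [mr r1] := reset_law_supp w eH.
rewrite -(probability_supportI mr r1 mA); apply: iff_sym.
apply: equivalent_positive; rewrite ?r1 ?lte_fin//.
- exact: many_nonempty.
- by move=> fr mr' Y; exact: finite_many_nonempty fr mr'.
case: (rc e w eH) => [[fr [_ eq]]|[r0 [_ eq]]]; [left|right]; split=> //.
- rewrite eq//; last exact: measurableI.
  by apply: counting_gt0; exact: sub_finite_set fr.
- by move=> _; apply/lebesgue_Rn_many.
- rewrite eq//; last exact: measurableI.
  by apply: lebesgue_Rn_many => //; exact: measurableI.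
Qed.

Lemma delays_edgeE s e tau : delays_edge H s e tau <->
  delay H tau s (elapse H s tau) /\ enabled H e (elapse H s tau).
Proof.
split=> [[s' [s1 [[t0 inv ->] sw]]]|[dl [s' sw]]]; first by split; [|exists s'].
by exists s', (elapse H s tau).
Qed.

Lemma good_delaysE s X :
  (forall e w, e \in edges H -> positive_reset e w (section X (target e)) <->
     (0 < reset_law H e w (section X (target e)))%E) ->
  good_delays s X = delays H s `&` hits H s X.
Proof.
move=> pos; apply/seteqP; split=> tau.
  move=> [e [eH es de /(pos _ _ eH) r0]]; split; first by exists e.
  by exists e; split=> //; case/delays_edgeE: de.
case=> -[e0 _ /delays_edgeE[dl _]] [e [eH es en r0]].
by exists e; split=> //; [exact/delays_edgeE|exact/pos].
Qed.

(** An infinite definable set of delays contains an interval; the Lebesgue case of the delay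
    condition thus falls under the first disjunct of [pre]. *)
Lemma preP (K : R.-pker S ~> S) s X : induces H K -> delay_condition H -> measurable X ->
  good_delays s X = delays H s `&` hits H s X ->
  finite_union_of_points_and_open_intervals (good_delays s X) ->
  finite_union_of_points_and_open_intervals (delays H s) ->
  pre X s <-> (0 < K s X)%E.
Proof.
move=> HK dc mX gE tg td; have [mg ->] := kernel_gt0 HK s mX; rewrite -gE in mg *.
have [mD D1] := delay_law_supp H s; apply: iff_sym.
have gD : good_delays s X `<=` delays H s by rewrite gE; exact: subIsetl.
apply: (@equivalent_positive _ _ _ (@many1 R) (delays H s)); rewrite ?D1 ?lte_fin//.
- by move=> Y [a [b [ab Y_]]]; exists ((a + b) / 2); apply: Y_;
    rewrite /= in_itv /= midf_lt// midf_lt.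
- by move=> fD /many1_infinite.
have [dfin dinf] := dc s; have [fD|iD] := pselect (finite_set (delays H s)); [left|right].
  split=> //; have [_ ->//] := dfin fD; exact: discrete_uniform_gt0.
split; first by move=> _; apply: contrapT => /(tame1_finite td).
have [_ ->//] := dinf iD; exact: tame1_lebesgue.
Qed.

Definition positive_section X := exists l, many (section X l).

Lemma finite_section D l : finite_set D -> finite_set (section D l).
Proof.
move=> fD; apply: (@sub_finite_set _ _ [set s.2 | s in D]); last exact: finite_image.
by move=> v Dv; exists (l, v).
Qed.

Lemma lebesgue_state_gt0 X : measurable X -> (forall l, tame (section X l)) ->
  (0 < lebesgue_state X)%E <-> positive_section X.
Proof.
move=> mX tX; have XP l := lebesgue_Rn_many (measurable_section l mX) (tX l).
split=> [|[l /XP Xl]].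
  apply: contraPP => nX; rewrite /lebesgue_state big1 ?ltxx// => l _.
  apply/eqP; rewrite eq_le lebesgue_Rn_ge0 andbT leNgt; apply/negP => /XP mXl.
  by apply: nX; exists l.
apply: lt_le_trans Xl _; rewrite /lebesgue_state (bigD1 l)//= leeDl//.
by apply: sume_ge0 => *; exact: lebesgue_Rn_ge0.
Qed.

(** The role of [large] is played by [positive_section]; in the Lebesgue case [D] itself is large
    because [mu D = 1]. *)
Lemma initial_positive (mu : probability S R) D X : initial_condition mu D ->
  measurable X -> (forall l, tame (section D l)) ->
  (forall l, tame (section (D `&` X) l)) ->
  (0 < mu X)%E <-> positive_section (D `&` X) \/
    ~ positive_section D /\ D `&` X !=set0.
Proof.
move=> ic mX tD tDX.
have [mD D1] : supported_on mu D by case: ic => [[_ []]|[]].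
have mDX := measurableI _ _ mD mX.
rewrite -(probability_supportI mD D1 mX).
apply: equivalent_positive; rewrite ?D1 ?lte_fin//.
- by move=> Y [l /many_nonempty[v Yv]]; exists (l, v).
- move=> fD [l Dl] Y [[l' v] Yv]; exists l'.
  by apply: (finite_many_nonempty (finite_section l fD)) => //; exists v.
case: ic => [[fD [_ eq]]|[_ eq]]; [left|right]; split=> //.
- apply: iff_trans (eq _ mDX (@subIsetl _ _ _)) _.
  by apply: counting_gt0; exact: sub_finite_set fD.
- move=> _; apply/lebesgue_state_gt0 => //.
  by apply/(eq D mD (fun _ => id)); rewrite D1 lte_fin.
- apply: iff_trans (eq _ mDX (@subIsetl _ _ _)) _; exact: lebesgue_state_gt0.
Qed.

End Predecessors.

(** * Correctness of the decision procedure *)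

Section RepresentedTame.
Variables (R : realType) (sg : signature) (M : structure R sg).
Hypothesis M_o_minimal : o_minimal M.
Variable N : nat.

Lemma represents_tame1 t X rho x : represents M N t X ->
  finite_union_of_points_and_open_intervals [set c | X (upd rho x c)].
Proof.
move=> [phi [_ _ sphi]].
have -> : [set c | X (upd rho x c)] = [set c | sat M (upd rho x c) phi].
  by apply/seteqP; split=> c /sphi.
exact: M_o_minimal.
Qed.

(** With the other variables fixed by [rho], the set of first coordinates whose slice is [many] is
    again defined by a formula; here o-minimality with parameters enters. *)
Lemma represents_tame t X rho a n : (a + n <= N)%N -> represents M N t X ->
  tame [set v : n.-tuple R | X (set_block rho a v)].
Proof.
move=> aN tX; elim: n rho a aN => [//|n IH] rho a aN /=.
have aN' : (a.+1 + n <= N)%N by lia.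
have E c : [set v : n.-tuple R | X (set_block rho a (c :: v))] =
    [set v : n.-tuple R | X (set_block (upd rho a c) a.+1 v)].
  by apply/seteqP; split=> v /=; rewrite set_block_cons.
split=> [|c]; last by rewrite E; exact: IH.
under eq_set do rewrite E.
exact: represents_tame1 (represents_manys aN' tX).
Qed.

End RepresentedTame.

Lemma block_cat (R : realType) (rho : nat -> R) a n1 n2 :
  block rho a (n1 + n2) = cat_tuple (block rho a n1) (block rho (a + n1) n2).
Proof. by apply: val_inj; rewrite /= iotaD map_cat. Qed.

Section Algorithm.
Variables (R : realType) (sg : signature) (M : structure R sg).
Hypothesis M_o_minimal : o_minimal M.
Variables (k m n : nat) (H : stochastic_hybrid_system R k m n).
Variables (B D : set (state R k n)) (I : presentation sg k m n).
Hypothesis IP : presents M I H B D.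
Local Notation V := (n.-tuple R).
Local Notation S := (state R k n).
Implicit Types (e : edge k m) (l : location k) (X Y : set S) (rho : nat -> R).

Let rv := (n + n).+1.
Let rw := (rv + n)%N.
Let ru := (rw + n)%N.
Let rtau := (ru + n)%N.
Let rt := rtau.+1.
Let N := rt.+1.
Local Notation rep := (represents M N).

Let regE : (reg_v (enc_nat n) = enc_nat rv) * (reg_w (enc_nat n) = enc_nat rw) *
  (reg_u (enc_nat n) = enc_nat ru) * (reg_tau (enc_nat n) = enc_nat rtau) *
  (reg_t (enc_nat n) = enc_nat rt) * (reg_top (enc_nat n) = enc_nat N).
Proof.
have nodeE x : Node Leaf (enc_nat x) = enc_nat x.+1 by [].
by rewrite /reg_top /reg_t /reg_tau /reg_u /reg_w /reg_v !(tree_addE, nodeE).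
Qed.

Local Ltac reg_lia := rewrite ?size_tuple /N /rt /rtau /ru /rw /rv; lia.

Let edgesE : pr_edges I = edges H. Proof. by case: IP. Qed.

Lemma set_block_w rho (w : V) :
  [/\ block (set_block rho rw w) rw n = w,
      block (set_block rho rw w) rv n = block rho rv n,
      set_block rho rw w rtau = rho rtau & set_block rho rw w rt = rho rt].
Proof.
split; [exact: block_set_block|by apply: block_set_block_disjoint; reg_lia| |];
  by apply: set_block_out; reg_lia.
Qed.

Lemma set_block_u rho (u : V) :
  block (set_block rho ru u) ru n = u /\
  block (set_block rho ru u) rw n = block rho rw n.
Proof.
by split; [exact: block_set_block|apply: block_set_block_disjoint; reg_lia].
Qed.

Lemma represents_at t (A : set V) a : (n <= a)%N -> (a + n <= N)%N ->
  rep t [set rho | A (block rho 0 n)] ->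
  rep (tree_at (enc_nat n) (enc_nat a) t) [set rho | A (block rho a n)].
Proof.
move=> na aN tA.
apply: represents_ext (represents_plug (a := 0) (b := a) (n := n) _ _ _ tA) _.
- by rewrite add0n na.
- by reg_lia.
- exact: aN.
- by move=> rho /=; rewrite block_set_block.
Qed.

Lemma represents_flow l x : (rtau <= x <= rt)%N ->
  rep (tree_flow (enc_nat n) (enc_location I l) (enc_nat x))
    [set rho | 0 <= rho x /\ block rho rw n = flow H l (block rho rv n) (rho x)].
Proof.
move=> xt; have [_ /(_ l)[dflow _ _ _] _] := IP.
have nN : (n + n.+1 <= N)%N by reg_lia.
rewrite /tree_flow !regE; have X0 := represents_defines nN dflow.
have h1 : (n.+1 + n <= rw)%N || (rw + n <= n.+1)%N by reg_lia.
have h2 : (n.+1 + n <= N)%N by reg_lia.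
have h3 : (rw + n <= N)%N by reg_lia.
have X1 := represents_plug h1 h2 h3 X0.
have h4 : (n + 1 <= x)%N || (x + 1 <= n)%N by move: xt; reg_lia.
have h5 : (n + 1 <= N)%N by reg_lia.
have h6 : (x + 1 <= N)%N by move: xt; reg_lia.
have X2 := represents_plug h4 h5 h6 X1.
have h7 : (0 + n <= rv)%N || (rv + n <= 0)%N by reg_lia.
have h8 : (0 + n <= N)%N by reg_lia.
have h9 : (rv + n <= N)%N by reg_lia.
apply: represents_ext (represents_plug h7 h8 h9 X2) _ => rho.
rewrite /mkset.
(* After the three overwritings variables 0 to 2n hold the start point, the time and the end point,
   as the flow formula expects. *)
set r1 := set_block rho 0 _; set r2 := set_block r1 n _; set r3 := set_block r2 n.+1 _.
have b1 : block r3 0 n = block rho rv n.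
  rewrite block_set_block_disjoint; last by rewrite size_tuple; lia.
  rewrite block_set_block_disjoint; last by rewrite size_tuple; lia.
  exact: block_set_block.
have r1x : r1 x = rho x by apply: set_block_out; move: xt; reg_lia.
have b2 : r3 n = rho x.
  rewrite /r3 set_block_out ?size_tuple; last lia.
  by rewrite /r2 /set_block size_tuple leqnn addn1 leqnn subnn.
have b3 : block r3 n.+1 n = block rho rw n.
  rewrite block_set_block !block_set_block_disjoint//; reg_lia.
have -> : block r3 0 (n + n.+1) =
    [tuple of block rho rv n ++ rho x :: block rho rw n].
  by apply: val_inj; rewrite block_cat add0n block_cons b2 b3 b1.
split=> [[v [t [t0 /(congr1 val)/eqP]]]|[x0 e]].
  rewrite /= eqseq_cat ?size_tuple// eqseq_cons => /and3P[].
  move=> /eqP vE /eqP -> /eqP fE; have -> : block rho rv n = v by exact: val_inj.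
  by split=> //; exact: val_inj.
by exists (block rho rv n), (rho x); split=> //; rewrite -e.
Qed.

Lemma represents_reset e : e \in edges H ->
  rep (tree_reset (enc_nat n) (enc_edge I e))
    [set rho | reset H e (block rho rw n) (block rho ru n)].
Proof.
move=> eH; have [_ _ /(_ e eH)[_ dreset]] := IP.
have nN : (n + n <= N)%N by reg_lia.
rewrite /tree_reset !regE; have X0 := represents_defines nN dreset.
have h1 : (n + n <= ru)%N || (ru + n <= n)%N by reg_lia.
have h2 : (ru + n <= N)%N by reg_lia.
have X1 := represents_plug h1 nN h2 X0.
have h3 : (0 + n <= rw)%N || (rw + n <= 0)%N by reg_lia.
have h4 : (0 + n <= N)%N by reg_lia.
have h5 : (rw + n <= N)%N by reg_lia.
apply: represents_ext (represents_plug h3 h4 h5 X1) _ => rho.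
rewrite /mkset; set r1 := set_block rho 0 _; set r2 := set_block r1 n _.
have -> : block r2 0 (n + n) = [tuple of block rho rw n ++ block rho ru n].
  apply: val_inj; rewrite block_cat add0n block_set_block_disjoint ?size_tuple; last lia.
  by rewrite !block_set_block block_set_block_disjoint//; reg_lia.
split=> [[v [v' [r /(congr1 val)/eqP]]]|r].
  rewrite /= eqseq_cat ?size_tuple// => /andP[/eqP vE /eqP vE'].
  have -> : block rho rw n = v by exact: val_inj.
  by have -> : block rho ru n = v' by exact: val_inj.
by exists (block rho rw n), (block rho ru n).
Qed.

Lemma represents_invariant l a : (n <= a)%N -> (a + n <= N)%N ->
  rep (tree_at (enc_nat n) (enc_nat a) (loc_invariant (enc_location I l)))
    [set rho | loc_inv H l (block rho a n)].
Proof.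
move=> na aN; apply: represents_at => //; have [_ /(_ l)[_ dinv _ _] _] := IP.
by apply: represents_defines dinv; reg_lia.
Qed.

Definition stays l (v : V) (tau : R) :=
  forall t, 0 <= t <= tau -> loc_inv H l (flow H l v t).

Lemma represents_stay l : rep (tree_stay (enc_nat n) (enc_location I l))
  [set rho | stays l (block rho rv n) (rho rtau)].
Proof.
have lt1 : (rtau < N)%N by reg_lia.
have lt2 : (rt < N)%N by reg_lia.
have h1 : (n <= rw)%N by reg_lia.
have h2 : (rw + n <= N)%N by reg_lia.
have ht : (rtau <= rt <= rt)%N by reg_lia.
rewrite /tree_stay !regE; apply: represents_ext.
  exact: represents_not (represents_ex rt (represents_exs rw n
    (represents_and (represents_flow l ht) (represents_and
      (represents_not (represents_lt M lt1 lt2))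
      (represents_not (represents_invariant l h1 h2)))))).
move=> rho /=; split=> [st t /andP[t0 ttau]|st [t [w []]]].
  apply: contrapT => ninv; apply: st; exists t, (flow H l (block rho rv n) t).
  have [-> -> -> ->] := set_block_w (upd rho rt t) (flow H l (block rho rv n) t).
  rewrite upd_same upd_other; last by reg_lia.
  rewrite block_upd; last by reg_lia.
  by split=> //; split=> //; apply/negP; rewrite -leNgt.
have [-> -> -> ->] := set_block_w (upd rho rt t) w.
rewrite upd_same upd_other; last by reg_lia.
rewrite block_upd; last by reg_lia.
move=> [t0 ->] [/negP ttau]; apply; apply: st.
by rewrite t0 leNgt.
Qed.

Let locs := enc_seq [seq enc_location I l | l <- enum 'I_k.+1].
Let edgs := enc_seq [seq enc_edge I e | e <- enum (pr_edges I)].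

Lemma nth_enum_enc (f : location k -> tree) l :
  tree_nth (enc_seq [seq f l | l <- enum 'I_k.+1]) (enc_nat l) = f l.
Proof.
have ls : (l < size (enum 'I_k.+1))%N by rewrite size_enum_ord.
rewrite tree_nthE; last by rewrite size_map.
by rewrite (@nth_map _ ord0 _ Leaf f l (enum 'I_k.+1))// nth_ord_enum.
Qed.

Definition fires e (w : V) :=
  [/\ loc_inv H (source e) w, guard H e w
    & exists u, reset H e w u /\ loc_inv H (target e) u].

Lemma represents_fire e : e \in edges H ->
  rep (tree_fire (enc_nat n) locs (enc_location I (source e)) (enc_edge I e))
    [set rho | (0 <= rho rtau /\
        block rho rw n = flow H (source e) (block rho rv n) (rho rtau)) /\
      fires e (block rho rw n)].
Proof.
move=> eH; have [_ _ /(_ e eH)[dguard _]] := IP.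
have ht : (rtau <= rtau <= rt)%N by reg_lia.
have h1 : (n <= rw)%N by reg_lia.
have h2 : (rw + n <= N)%N by reg_lia.
have h3 : (n <= ru)%N by reg_lia.
have h4 : (ru + n <= N)%N by reg_lia.
have nN : (n <= N)%N by reg_lia.
rewrite /tree_fire !regE nth_enum_enc; apply: represents_ext.
  exact: represents_and (represents_flow _ ht) (represents_and
    (represents_invariant _ h1 h2) (represents_and
      (represents_at h1 h2 (represents_defines nN dguard))
      (represents_exs ru n (represents_and (represents_reset eH)
        (represents_invariant _ h3 h4))))).
move=> rho /=; split=> [[? [inv [g [u]]]]|[? [inv g [u]]]].
  have [-> ->] := set_block_u rho u.
  by move=> ?; split=> //; split=> //; exists u.
move=> ?; split=> //; split=> //; split=> //; exists u.
by have [-> ->] := set_block_u rho u.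
Qed.

(** Sources of edges are compared by the program, not by the formula: locations are not elements of
    [M]. *)
Lemma represents_edges l (F : tree -> tree) (X : edge k m -> set (nat -> R)) :
  (forall e, e \in edges H -> source e = l -> rep (F (enc_edge I e)) (X e)) ->
  rep (foldr (fun u p => tree_if (tree_neq (edge_src u) (enc_nat l)) (tree_or (F u) p) p)
         tree_bot (elems edgs))
    [set rho | exists e, [/\ e \in edges H, source e = l & X e rho]].
Proof.
move=> FX; rewrite elems_enc_seq; apply: represents_ext.
  apply: (@represents_bigor _ _ M N _ _ _ _ (fun e => [set rho | source e = l /\ X e rho])).
  move=> e p Y; rewrite mem_enum edgesE => eH pY.
  rewrite (tree_neqE (source e) l); case: eqP => [sl|nsl].
    apply: represents_ext (represents_or (FX e eH (val_inj sl)) pY) _ => rho /=.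
    split=> [[Xe|Yr]|[[_ Xe]|Yr]]; [left|right|left|right] => //.
    by split=> //; exact: val_inj.
  apply: represents_ext pY _ => rho /=; split=> [|[[sl _]|]//]; first by right.
  by case: nsl; rewrite sl.
move=> rho /=; split=> [[e]|[e [eH sl Xe]]].
  by rewrite mem_enum edgesE => eH [sl Xe]; exists e.
by exists e; rewrite ?mem_enum ?edgesE.
Qed.

Definition represents_list t X := exists f : location k -> tree,
  t = enc_seq [seq f l | l <- enum 'I_k.+1] /\
  forall l, rep (f l) [set rho | X (l, block rho 0 n)].

Lemma represents_list_nth t X l : represents_list t X ->
  rep (tree_nth t (enc_nat l)) [set rho | X (l, block rho 0 n)].
Proof. by move=> [f [-> fX]]; rewrite nth_enum_enc. Qed.

Let set_blockuE rho (P : V -> V -> Prop) :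
  [set u : V | P (block (set_block rho ru u) rw n) (block (set_block rho ru u) ru n)] =
  P (block rho rw n).
Proof. by apply/funext => u /=; have [-> ->] := set_block_u rho u. Qed.

Let run : (ru + n <= N)%N. Proof. by reg_lia. Qed.
Let nru : (n <= ru)%N. Proof. by reg_lia. Qed.

Lemma represents_reset_target t X e : e \in edges H -> represents_list t X ->
  rep (tree_and (tree_reset (enc_nat n) (enc_edge I e))
        (tree_at (enc_nat n) (enc_nat ru) (tree_nth t (enc_nat (target e)))))
    [set rho | (reset H e (block rho rw n) `&` section X (target e)) (block rho ru n)].
Proof.
move=> eH tX; apply: represents_and (represents_reset eH) _.
exact: (@represents_at _ (section X (target e)) ru nru run
  (represents_list_nth (target e) tX)).
Qed.

Lemma represents_hit t X e : e \in edges H -> represents_list t X ->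
  rep (tree_hit (enc_nat n) t (enc_edge I e))
    [set rho | positive_reset H e (block rho rw n) (section X (target e))].
Proof.
move=> eH tX; have rX := represents_reset_target eH tX.
rewrite /tree_hit !regE; apply: represents_ext.
  exact: represents_or (represents_manys run rX)
    (represents_and (represents_not (represents_manys run (represents_reset eH)))
      (represents_exs ru n rX)).
move=> rho; rewrite /positive_reset /mkset.
have E1 := set_blockuE rho (fun w u => (reset H e w `&` section X (target e)) u).
have E2 := set_blockuE rho (reset H e).
rewrite /mkset in E1 E2; cbv beta in E1, E2; rewrite E1 E2.
split=> -[?|[nr [u ru_]]]; [by left|right|by left|right]; split=> //; by exists u.
Qed.

Lemma delays_edge_fires e (v : V) tau : e \in edges H ->
  delays_edge H (source e, v) e tau <->
  [/\ 0 <= tau, stays (source e) v tau & fires e (flow H (source e) v tau)].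
Proof.
move=> eH; rewrite delays_edgeE; split=> [[[t0 st _] [s' [[_ _ te] [i1 g r i2]]]]|].
  by split=> //; split=> //; exists s'.2.
move=> [t0 st [i1 g [u [r i2]]]]; split; first by split.
by exists (target e, u).
Qed.

(** Common part of [tree_delays] and [tree_good_delays], which differ in the condition [P] on the
    point at which the switch occurs. *)
Lemma represents_delays_gen l (F : tree -> tree) (P : edge k m -> V -> Prop) :
  (forall e, e \in edges H -> source e = l ->
    rep (F (enc_edge I e)) [set rho | ((0 <= rho rtau /\
      block rho rw n = flow H l (block rho rv n) (rho rtau)) /\
      fires e (block rho rw n)) /\ P e (block rho rw n)]) ->
  rep (tree_and (tree_stay (enc_nat n) (tree_nth locs (enc_nat l)))
    (tree_exs (reg_w (enc_nat n)) (enc_nat n)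
      (foldr (fun u p => tree_if (tree_neq (edge_src u) (enc_nat l)) (tree_or (F u) p) p)
         tree_bot (elems edgs))))
    [set rho | exists e, [/\ e \in edges H, source e = l,
       delays_edge H (l, block rho rv n) e (rho rtau)
       & P e (flow H l (block rho rv n) (rho rtau))]].
Proof.
move=> FP; rewrite nth_enum_enc !regE; apply: represents_ext.
  exact: represents_and (represents_stay l) (represents_exs rw n (represents_edges FP)).
move=> rho /=; split=> [[st [w [e [eH sl]]]]|[e [eH sl]]].
  have [-> -> -> _] := set_block_w rho w => -[[[t0 ->] fi] Pe].
  exists e; split=> //; move: st fi; rewrite -sl => st fi.
  exact/delays_edge_fires.
rewrite -sl => /(delays_edge_fires _ _ eH)[t0 st fi] Pe; split=> //.
exists (flow H (source e) (block rho rv n) (rho rtau)), e; split=> //.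
by have [-> -> -> _] := set_block_w rho (flow H (source e) (block rho rv n) (rho rtau)).
Qed.

Lemma represents_delays l : rep (tree_delays (enc_nat n) edgs locs (enc_nat l))
  [set rho | delays H (l, block rho rv n) (rho rtau)].
Proof.
apply: represents_ext.
  apply: (@represents_delays_gen l _ (fun _ _ => True)) => e eH sl.
  rewrite nth_enum_enc -sl; apply: represents_ext (represents_fire eH) _ => rho.
  by split=> [|[]].
move=> rho; split=> [[e [eH _ de _]]|[e eH de]]; first by exists e.
exists e; split=> //; move: de => [s' [s1 [[_ _ ->] [[_ <-]]]]].
by [].
Qed.

Lemma represents_good_delays t X l : represents_list t X ->
  rep (tree_good_delays (enc_nat n) edgs locs t (enc_nat l))
    [set rho | good_delays H (l, block rho rv n) X (rho rtau)].
Proof.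
move=> tX; apply: (@represents_delays_gen l _
  (fun e w => positive_reset H e w (section X (target e)))) => e eH sl.
rewrite nth_enum_enc -sl.
exact: represents_and (represents_fire eH) (represents_hit eH tX).
Qed.

Lemma represents_pre t X l : represents_list t X ->
  rep (tree_pre (enc_nat n) edgs locs t (enc_nat l))
    [set rho | pre H X (l, block rho 0 n)].
Proof.
move=> tX; have taun : (rtau < N)%N by reg_lia.
have h1 : (rv + n <= 0)%N || (0 + n <= rv)%N by reg_lia.
have h2 : (rv + n <= N)%N by reg_lia.
have h3 : (0 + n <= N)%N by reg_lia.
have rg := represents_good_delays l tX; have rd := represents_delays l.
rewrite /tree_pre !regE; apply: represents_ext.
  apply: (represents_plug h1 h2 h3).
  exact: represents_or (represents_many taun rg) (represents_and
    (represents_not (represents_many taun rd)) (represents_ex rtau rg)).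
move=> rho; rewrite /pre /mkset.
set r := set_block rho rv _.
have br c : block (upd r rtau c) rv n = block rho 0 n.
  rewrite block_upd; last by reg_lia.
  exact: block_set_block.
have gE : [set c | good_delays H (l, block (upd r rtau c) rv n) X (upd r rtau c rtau)] =
    good_delays H (l, block rho 0 n) X.
  by apply/funext => c /=; rewrite br upd_same.
have dE : [set c | delays H (l, block (upd r rtau c) rv n) (upd r rtau c rtau)] =
    delays H (l, block rho 0 n).
  by apply/funext => c /=; rewrite br upd_same.
rewrite /mkset in gE dE; rewrite gE dE.
split=> -[?|[nd [tau g]]]; [by left|right|by left|right]; split=> //;
  by exists tau.
Qed.

Let inp := enc_presentation I.

Lemma enc_seq_map (T : Type) (f : T -> tree) (g : tree -> tree) (r : seq T) :
  foldr (fun x t => Node (g x) t) Leaf [seq f x | x <- r] =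
  enc_seq [seq g (f x) | x <- r].
Proof. by rewrite foldr_map; elim: r => //= x r ->. Qed.

Let elems_locations : elems (tree_range Leaf (inp_locations inp)) =
  [seq enc_nat l | l <- enum 'I_k.+1].
Proof. by rewrite (tree_rangeE 0 k.+1) elems_enc_seq -val_enum_ord -map_comp. Qed.

Lemma represents_targets : represents_list (tree_targets inp) B.
Proof.
exists (fun l => enc_formula (pr_target I l)); split.
  by rewrite /tree_targets -[inp_locs _]/(locs) elems_enc_seq enc_seq_map.
move=> l; have [_ /(_ l)[_ _ dB _] _] := IP.
by apply: represents_ext (represents_defines _ dB) _ => //; reg_lia.
Qed.

Lemma represents_complement t X : represents_list t X ->
  represents_list (tree_complement t) (~` X).
Proof.
move=> [f [-> fX]]; exists (fun l => tree_not (f l)); split.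
  by rewrite /tree_complement elems_enc_seq enc_seq_map.
by move=> l; exact: represents_not (fX l).
Qed.

Lemma represents_step t u T X : represents_list t T -> represents_list u X ->
  represents_list (tree_step inp t u) (T `|` (~` B `&` pre H X)).
Proof.
move=> tT uX; eexists; split.
  rewrite /tree_step elems_locations enc_seq_map; reflexivity.
move=> l /=; apply: represents_or; first exact: represents_list_nth.
rewrite -[inp_locs _]/(locs) nth_enum_enc.
have [_ /(_ l)[_ _ dB _] _] := IP.
have nN : (n <= N)%N by reg_lia.
apply: represents_and; first exact: represents_not (represents_defines nN dB).
exact: represents_pre.
Qed.

Lemma represents_some_loc (f : tree -> tree) (X : location k -> set (nat -> R)) :
  (forall l, rep (f (enc_nat l)) (X l)) ->
  rep (tree_some_loc f inp) [set rho | exists l, X l rho].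
Proof.
move=> fX; rewrite /tree_some_loc elems_locations; apply: represents_ext.
  by apply: represents_bigor => l p Y _; exact: represents_or (fX l).
by move=> rho; split=> -[l]; exists l; rewrite ?mem_enum.
Qed.

Lemma represents_init t X : represents_list t X ->
  rep (tree_init inp t) [set _ | positive_section (D `&` X) \/
    ~ positive_section D /\ D `&` X !=set0].
Proof.
move=> tX; have nN : (0 + n <= N)%N by reg_lia.
have dD l : rep (loc_support (tree_nth (inp_locs inp) (enc_nat l)))
    [set rho | D (l, block rho 0 n)].
  rewrite -[inp_locs _]/(locs) nth_enum_enc; have [_ /(_ l)[_ _ _ dD] _] := IP.
  exact: represents_defines dD.
have dDX l := represents_and (dD l) (represents_list_nth l tX).
rewrite /tree_init -[inp_n _]/(enc_nat n) !regE.
have bE rho (A : set V) : [set v : V | A (block (set_block rho 0 v) 0 n)] = A.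
  by apply/funext => v /=; rewrite block_set_block.
apply: represents_ext.
  apply: represents_or.
    by apply: represents_some_loc => l; exact: (represents_manys nN (dDX l)).
  apply: represents_and.
    apply: represents_not.
    by apply: represents_some_loc => l; exact: (represents_manys nN (dD l)).
  by apply: represents_some_loc => l; exact: (represents_exs 0 n (dDX l)).
move=> rho /=.
have DE l : many [set v : V | D (l, block (set_block rho 0 v) 0 n)] = many (section D l).
  by rewrite (bE rho (section D l)).
have DXE l : many [set v : V | D (l, block (set_block rho 0 v) 0 n) /\
    X (l, block (set_block rho 0 v) 0 n)] = many (section (D `&` X) l).
  by rewrite (bE rho (section (D `&` X) l)).
rewrite /positive_section; split=> -[[l]|[nd]].
- by rewrite DXE; left; exists l.
- move=> [l [v]]; rewrite block_set_block => DX; right; split; last by exists (l, v).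
  by move=> [l' Dl']; apply: nd; exists l'; rewrite DE.
- by left; exists l; rewrite DXE.
- move=> [[l v] DX]; right; split; last by exists l, v; rewrite block_set_block.
  by move=> [l']; rewrite DE => ?; apply: nd; exists l'.
Qed.

Section Kernel.
Variable K : R.-pker S ~> S.
Hypotheses (HK : induces H K) (dc : delay_condition H) (rc : reset_condition H).

(** The code of [X] is what makes the sets of delays and resets involved tame, and tameness is what
    lets [many] stand for positive Lebesgue measure. *)
Lemma pre_kernel t X : represents_list t X -> measurable X ->
  pre H X = [set s | (0 < K s X)%E].
Proof.
move=> tX mX.
have bw (w : V) : block (set_block (fun=> 0) rw w) rw n = w by exact: block_set_block.
have bv (v : V) c : block (upd (set_block (fun=> 0) rv v) rtau c) rv n = v.
  by rewrite block_upd ?block_set_block//; reg_lia.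
have gE s : good_delays H s X = delays H s `&` hits H s X.
  apply: good_delaysE => e w eH; apply: positive_resetP => //.
  - exact: measurable_section.
  - have := represents_tame M_o_minimal (set_block (fun=> 0) rw w) run (represents_reset eH).
    by congr tame; apply/funext => u /=; have [-> ->] := set_block_u (set_block (fun=> 0) rw w) u;
      rewrite bw.
  - have := represents_tame M_o_minimal (set_block (fun=> 0) rw w) run
      (represents_reset_target eH tX).
    by congr tame; apply/funext => u /=; have [-> ->] := set_block_u (set_block (fun=> 0) rw w) u;
      rewrite bw.
have tg s : finite_union_of_points_and_open_intervals (good_delays H s X).
  have := represents_tame1 M_o_minimal (set_block (fun=> 0) rv s.2) rtau
    (represents_good_delays s.1 tX).
  by congr finite_union_of_points_and_open_intervals; apply/funext => c /=;
    rewrite bv upd_same -surjective_pairing.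
have td s : finite_union_of_points_and_open_intervals (delays H s).
  have := represents_tame1 M_o_minimal (set_block (fun=> 0) rv s.2) rtau
    (represents_delays s.1).
  by congr finite_union_of_points_and_open_intervals; apply/funext => c /=;
    rewrite bv upd_same -surjective_pairing.
have P s := preP HK dc mX (gE s) (tg s) (td s).
by apply/seteqP; split=> s /P.
Qed.

Hypothesis mB : measurable B.

(** Every iterate must be both represented, to form the next code, and measurable, to identify [pre]
    with positivity of the kernel. *)
Lemma represents_reach t T : represents_list t T -> measurable T ->
  represents_list (tree_reach inp t) (reach K T (~` B) (#|edges H|.+1 * k.+1)).
Proof.
move=> tT mT.
have inner (r : seq tree) u j : represents_list u (reach K T (~` B) j) ->
    represents_list (foldr (fun _ q => tree_step inp t q) u r)
      (reach K T (~` B) (size r + j)).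
  move=> uj; elim: r => //= _ r IH; have mr : measurable (reach K T (~` B) (size r + j)).
    by apply: measurable_reach => //; exact: measurableC.
  by have := represents_step tT IH; rewrite (pre_kernel IH mr).
have outer (r : seq tree) : represents_list
    (foldr (fun _ p => foldr (fun _ q => tree_step inp t q) p
       (elems (inp_locations inp))) t r) (reach K T (~` B) (size r * k.+1)).
  have sz : size (elems (inp_locations inp)) = k.+1.
    by rewrite -[inp_locations _]/(enc_nat k.+1) elems_enc_nat size_nseq.
  elim: r => [//|x r IH]; rewrite [size _]/= mulSn.
  by have := inner (elems (inp_locations inp)) _ _ IH; rewrite sz.
have sz : size (elems (Node Leaf (inp_edges inp))) = #|edges H|.+1.
  by rewrite -[LHS]/(size (elems edgs)).+1 elems_enc_seq size_map -cardE edgesE.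
by have := outer (elems (Node Leaf (inp_edges inp))); rewrite sz.
Qed.

End Kernel.

Lemma represents_null t X : represents_list t X -> exists phi : formula sg,
  [/\ tree_null inp t = enc_formula phi, free_vars phi = [::]
    & (forall rho, sat M rho phi) <->
      ~ (positive_section (D `&` X) \/ ~ positive_section D /\ D `&` X !=set0)].
Proof.
move=> /represents_init/represents_not[phi [tphi fphi sphi]].
(* The free variables of [phi] lie below [N], so this prefix binds them all; the truth of [phi] does
   not depend on the valuation, so the prefix preserves it. *)
exists (foldr (@FEx sg) phi (iota 0 N)); split.
- rewrite /tree_null -[inp_n _]/(enc_nat n) !regE tphi /tree_exs (tree_rangeE 0 N).
  by rewrite elems_enc_seq foldr_map; elim: (iota 0 N) => //= x r ->.
- have fE r x : x \in free_vars (foldr (@FEx sg) phi r) -> x \in free_vars phi /\ x \notin r.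
    elim: r => //= y r IH; rewrite mem_filter inE negb_or => /andP[-> /IH[]].
    by [].
  case E : (free_vars _) => [//|x xs]; have := fE (iota 0 N) x; rewrite E mem_head.
  move=> /(_ isT)[/(allP fphi) xN]; rewrite mem_iota add0n /=.
  by rewrite xN.
- have E r rho : sat M rho (foldr (@FEx sg) phi r) <->
      ~ (positive_section (D `&` X) \/ ~ positive_section D /\ D `&` X !=set0).
    elim: r rho => [|x r IH] rho /=; first exact: sphi.
    by split=> [[c /IH]//|?]; exists 0; exact/IH.
  by split=> [/(_ (fun=> 0))/E|? rho]; last exact/E.
Qed.

Section Decision.
Hypotheses (cr : cycle_reset H) (mB : measurable B).
Variables (mu : probability S R) (K : R.-pker S ~> S) (Prob : probability (runs S) R).
Hypotheses (HK : induces H K) (lawP : run_law mu K Prob).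
Hypotheses (dc : delay_condition H) (ic : initial_condition mu D) (rc : reset_condition H).

Local Notation bound := (#|edges H|.+1 * k.+1)%N.

Lemma represents_null_probability t X : represents_list t X -> measurable X ->
  exists phi : formula sg, [/\ tree_null inp t = enc_formula phi, free_vars phi = [::]
    & (forall rho, sat M rho phi) <-> ~ (0 < mu X)%E].
Proof.
move=> tX mX; have [phi [tphi fphi sphi]] := represents_null tX; exists phi; split=> //.
rewrite sphi; have nN : (0 + n <= N)%N by reg_lia.
have [_ dloc _] := IP; have nN' : (n <= N)%N by reg_lia.
have dD l : rep (enc_formula (pr_support I l)) [set rho | D (l, block rho 0 n)].
  by have [_ _ _ dD] := dloc l; exact: represents_defines dD.
have tDX l : tame (section D l) /\ tame (section (D `&` X) l).
  have td := represents_tame M_o_minimal (fun=> 0) nN (dD l).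
  have tdx := represents_tame M_o_minimal (fun=> 0) nN
    (represents_and (dD l) (represents_list_nth l tX)).
  by split; [move: td|move: tdx]; congr tame; apply/funext => v /=;
    rewrite block_set_block.
by rewrite (initial_positive ic mX (fun l => (tDX l).1) (fun l => (tDX l).2)).
Qed.

Lemma decide_zero_correct : exists phi : formula sg,
  [/\ tree_decide_zero inp = enc_formula phi, free_vars phi = [::]
    & (forall rho, sat M rho phi) <-> Prob (eventually_in B) = 0%E].
Proof.
have tB := represents_reach HK dc rc mB represents_targets mB.
have [phi [tphi fphi sphi]] := represents_null_probability tB
  (measurable_reach K bound mB (measurableC mB)).
exists phi; split=> //; rewrite sphi (prob_eventually_in_0 lawP mB (N := bound))// => j.
by apply: reach_stable => //; exact: measurableC.
Qed.

Lemma decide_one_correct : exists phi : formula sg,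
  [/\ tree_decide_one inp = enc_formula phi, free_vars phi = [::]
    & (forall rho, sat M rho phi) <-> Prob (eventually_in B) = 1%E].
Proof.
have mC := measurableC mB.
have tB := represents_reach HK dc rc mB represents_targets mB.
pose Z := ~` reach K B (~` B) bound.
have mP : measurable (reach K B (~` B) bound) by exact: measurable_reach.
have mZ : measurable Z by exact: measurableC.
have tZ := represents_reach HK dc rc mB (represents_complement tB) mZ.
have [phi [tphi fphi sphi]] := represents_null_probability tZ
  (measurable_reach K bound mZ mC).
have stableP j : reach K B (~` B) j `<=` reach K B (~` B) bound.
  exact: reach_stable.
have stableQ j : reach K Z (~` B) j `<=` reach K Z (~` B) bound.
  exact: reach_stable.
have mBZ : measurable (B `|` Z) by exact: measurableU.
(* Every state either reaches [B] with positive probability within [bound] steps or lies in [Z], so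
   avoidance of their union is below 1 everywhere. *)
have [W [c [c01 Wc]]] : exists W (c : R), (0 <= c < 1)%R /\
    forall s, (avoid K (B `|` Z) W s <= c%:E)%E.
  apply: (avoid_contract HK cr (N := bound) mBZ) => s.
  apply/avoid_lt1 => //; have [Ps|Zs] := pselect (reach K B (~` B) bound s); last first.
    by apply: reach0; right.
  by apply: reach_subset Ps => // x; left.
exists phi; split=> //; rewrite sphi.
by rewrite (prob_eventually_in_1 lawP mB stableP stableQ c01 Wc).
Qed.

End Decision.

End Algorithm.

Theorem proposition3p15 (R : realType) (sg : signature) (M : structure R sg)
    (M_o_minimal : o_minimal M) (M_decidable : decidable_theory M) :
  exists decide_one decide_zero : cmd,
  forall (k m n : nat) (H : stochastic_hybrid_system R k m n)
    (B D : set (state R k n)) (I : presentation sg k m n),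
    presents M I H B D ->
    cycle_reset H ->
    measurable B ->
  forall (mu : probability (state R k n) R)
    (K : R.-pker (state R k n) ~> (state R k n))
    (Prob : probability (runs (state R k n)) R),
    induces H K ->
    run_law mu K Prob ->
    delay_condition H ->
    initial_condition mu D ->
    reset_condition H ->
    answers decide_one (enc_presentation I) (Prob (eventually_in B) = 1%E) /\
    answers decide_zero (enc_presentation I) (Prob (eventually_in B) = 0%E).
Proof.
have [c cP] := M_decidable.
(* Both programs compute a sentence and hand it to the decision program [c] of the theory; they are
   fixed before the system is given. *)
have [d1 d1P] := outputs_computable c computable_decide_one.
have [d0 d0P] := outputs_computable c computable_decide_zero.
exists d1, d0 => k m n H B D I IP cr mB mu K Prob HK lawP dc ic rc.
have [phi1 [e1 f1 s1]] := decide_one_correct M_o_minimal IP cr mB HK lawP dc ic rc.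
have [phi0 [e0 f0 s0]] := decide_zero_correct M_o_minimal IP cr mB HK lawP dc ic rc.
have [t1 n1] := cP _ f1; have [t0 n0] := cP _ f0.
split; split=> Q.
- by apply: d1P; rewrite e1; apply: t1; exact/s1.
- by apply: d1P; rewrite e1; apply: n1 => /s1.
- by apply: d0P; rewrite e0; apply: t0; exact/s0.
- by apply: d0P; rewrite e0; apply: n0 => /s0.
Qed.
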